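(* Let $\mu$ be a Borel probability measure on $\mathbf{P}^{d-1}_{\mathbf{R}}$ and let $(S_n)_{n\in\mathbf{N}}$ be a sequence of independent random directions in $\mathbf{P}^{d-1}_{\mathbf{R}}$ (equivalently, of random Steiner symmetrizations), each with distribution $\mu$. The following are equivalent: (1) for every Lebesgue measurable set $X\subseteq\mathbf{R}^d$ of finite measure with $m(X\Delta X^\star)>0$, one has $$\mu(\{u\in\mathbf{P}^{d-1}_{\mathbf{R}} : m(X\Delta X^u)>0\})>0;$$ (2) for every Lebesgue measurable set $X\subseteq\mathbf{R}^d$ of finite measure, the sequence of successive Steiner symmetrizations $(X^{S_1\dots S_n})_{n\in\mathbf{N}}$ converges almost surely in measure to $X^\star$.
   Context: $\mathbf{N}=\{1,2,\dots\}$; $m$ is Lebesgue measure on $\mathbf{R}^d$; $\Delta$ is symmetric difference; $\mathbf{P}^{d-1}_{\mathbf{R}}$ is the real projective space of lines (directions) through the origin of $\mathbf{R}^d$ with its usual topology. Measurable sets are considered up to null sets. $X^\star$ denotes the spherical nonincreasing rearrangement of $X$: the open Euclidean ball centered at $0$ with $m(X^\star)=m(X)$. For $u\in\mathbf{P}^{d-1}_{\mathbf{R}}$ with linear span $\langle u\rangle$, the Steiner symmetrization $X^u$ of $X$ with respect to $u$ is the set (well defined up to null sets) such that for (almost) every $x\in u^\perp$, the section $X^u\cap(x+\langle u\rangle)$ is the open interval of the line $x+\langle u\rangle$ centered at $x$ with the same one-dimensional measure as $X\cap(x+\langle u\rangle)$. $X^{s_1\dots s_n}$ denotes the result of applying successively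 first $s_1$, then $s_2$, ..., then $s_n$: $X^{s_1\dots s_n}=(\cdots(X^{s_1})^{s_2}\cdots)^{s_n}$. Convergence in measure of $X_n$ to $Y$ means $m(X_n\Delta Y)\to0$. *)

(* Defs.v *)
From HB Require Import structures.
From mathcomp Require Import all_boot all_order all_algebra finmap.
From mathcomp Require Import all_classical all_reals all_analysis.

Set Implicit Arguments.
Unset Strict Implicit.
Unset Printing Implicit Defensive.
Import Order.TTheory GRing.Theory Num.Theory.
Import numFieldNormedType.Exports.

Local Open Scope classical_set_scope.
Local Open Scope ring_scope.

Definition measure_row_display : measure_display -> measure_display.
Proof. exact. Qed.

Section measurable_row.
Context d (T : measurableType d) (n : nat).

Let coors (i : 'I_n) (x : 'rV[T]_n) : T := x ord0 i.

Let row_set0 : g_sigma_preimage coors set0.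
Proof. exact: sigma_algebra0. Qed.

Let row_setC A : g_sigma_preimage coors A -> g_sigma_preimage coors (~` A).
Proof. exact: sigma_algebraC. Qed.

Let row_bigcup (F : _^nat) : (forall i, g_sigma_preimage coors (F i)) ->
  g_sigma_preimage coors (\bigcup_i (F i)).
Proof. exact: sigma_algebra_bigcup. Qed.

HB.instance Definition _ := @isMeasurable.Build (measure_row_display d)
  'rV[T]_n (g_sigma_preimage coors) row_set0 row_setC row_bigcup.

Lemma measurable_coord (i : 'I_n) :
  measurable_fun [set: 'rV[T]_n] (fun x : 'rV[T]_n => x ord0 i).
Proof.
move=> _ Y mY; rewrite setTI; apply: sub_sigma_algebra => /=.
rewrite -bigcup_seq/=; exists i => /=; first by rewrite mem_index_enum.
by exists Y => //; rewrite setTI.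
Qed.

Lemma measurable_fun_row d' (T' : measurableType d') (f : T' -> 'rV[T]_n) :
  (forall i, measurable_fun [set: T'] (fun t => f t ord0 i)) ->
  measurable_fun [set: T'] f.
Proof.
move=> mf; have : g_sigma_preimage (fun i => coors i \o f) `<=` measurable.
  apply: smallest_sub; first exact: sigma_algebra_measurable.
  move=> A; rewrite -bigcup_seq/= => -[i _ [B mB <-]].
  exact: (mf i).
by rewrite g_sigma_preimage_comp => + _ A mA; apply; exists A.
Qed.

End measurable_row.

Section lebesgue.
Context {R : realType}.

Definition row_cons n (p : measurableTypeR R * 'rV[R]_n) : 'rV[R]_n.+1 :=
  row_mx (p.1%:M : 'rV_1) p.2.

Lemma row_cons0 n p : @row_cons n p ord0 ord0 = p.1.
Proof.
rewrite /row_cons (_ : ord0 = lshift n (ord0 : 'I_1)); last exact/val_inj.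
by rewrite (row_mxEl (p.1%:M : 'rV_1)) mxE.
Qed.

Lemma row_consS n p (i : 'I_n) : @row_cons n p ord0 (lift ord0 i) = p.2 ord0 i.
Proof.
rewrite /row_cons (_ : lift ord0 i = rshift 1 i); last exact/val_inj.
by rewrite (row_mxEr (p.1%:M : 'rV_1)).
Qed.

Lemma measurable_row_cons n : measurable_fun setT (@row_cons n).
Proof.
apply: measurable_fun_row => i; case: (unliftP ord0 i) => [j|] ->.
  under eq_fun do rewrite row_consS.
  exact: (measurableT_comp (measurable_coord j) measurable_snd).
under eq_fun do rewrite row_cons0.
exact: measurable_fst.
Qed.

Section step.
Context n (mu : {sigma_finite_measure set 'rV[R]_n -> \bar R}).

Definition lebesgue_cons : set 'rV[R]_n.+1 -> \bar R :=
  pushforward (lebesgue_measure \x mu)%E (@row_cons n).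

Let lebesgue_cons0 : lebesgue_cons set0 = 0%E.
Proof. by rewrite /lebesgue_cons/= /pushforward preimage_set0 measure0. Qed.

Let lebesgue_cons_ge0 A : (0 <= lebesgue_cons A)%E.
Proof. exact: (@measure_ge0 _ _ _ (lebesgue_measure \x mu)%E). Qed.

Let lebesgue_cons_sigma_additive : semi_sigma_additive lebesgue_cons.
Proof.
move=> F mF tF mUF; rewrite /lebesgue_cons /pushforward preimage_bigcup.
apply: measure_semi_sigma_additive => [k||].
- by rewrite -[X in measurable X]setTI; exact: measurable_row_cons.
- apply/trivIsetP => /= i j _ _ ij; rewrite -preimage_setI.
  by move/trivIsetP : tF => /(_ _ _ _ _ ij) ->//; rewrite preimage_set0.
- rewrite -preimage_bigcup -[X in measurable X]setTI.
  exact: measurable_row_cons.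
Qed.

HB.instance Definition _ := isMeasure.Build _ _ _ lebesgue_cons
  lebesgue_cons0 lebesgue_cons_ge0 lebesgue_cons_sigma_additive.

Let lebesgue_cons_sigma_finite : sigma_finite setT lebesgue_cons.
Proof.
have /sigma_finiteP[F [TF ndF Foo]] := sigma_finiteT (@lebesgue_measure R).
have /sigma_finiteP[G [TG ndG Goo]] := sigma_finiteT mu.
pose h (x : 'rV[R]_n.+1) : measurableTypeR R * 'rV[R]_n :=
  (x ord0 ord0, \row_i x ord0 (lift ord0 i)).
have mh : measurable_fun setT h.
  apply/measurable_fun_pairP; split; first exact: measurable_coord.
  apply: measurable_fun_row => i.
  under eq_fun do rewrite /= mxE.
  exact: measurable_coord.
have hK p : h (row_cons p) = p.
  rewrite /h row_cons0 [p in RHS]surjective_pairing; congr (_, _).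
  by apply/rowP => i; rewrite mxE row_consS.
exists (fun k => h @^-1` (F k `*` G k)).
  apply/seteqP; split => // x _.
  have [i _ Fi] : (\bigcup_i F i) (h x).1 by rewrite -TF.
  have [j _ Gj] : (\bigcup_i G i) (h x).2 by rewrite -TG.
  exists (maxn i j) => //; split.
    by move: Fi; exact/subsetPset/ndF/leq_maxl.
  by move: Gj; exact/subsetPset/ndG/leq_maxr.
move=> k; have [mFk Fkoo] := Foo k; have [mGk Gkoo] := Goo k; split.
  by rewrite -[X in measurable X]setTI; apply: mh => //; exact: measurableX.
rewrite /lebesgue_cons /pushforward -comp_preimage.
rewrite (_ : h \o @row_cons n = id); last exact/funext.
by rewrite preimage_id product_measure1E// lte_mul_pinfty// ge0_fin_numE.
Qed.

HB.instance Definition _ := @Measure_isSigmaFinite.Build _ _ _ lebesgue_cons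
  lebesgue_cons_sigma_finite.

End step.

Fixpoint borel_lebesgue n : {sigma_finite_measure set 'rV[R]_n -> \bar R} :=
  match n with
  | 0 => @dirac _ 'rV[R]_0 0 R
  | k.+1 => lebesgue_cons (borel_lebesgue k)
  end.

Lemma borel_lebesgue_box n (A : 'I_n -> set R) :
  (forall i, measurable (A i)) ->
  borel_lebesgue n [set x | forall i, A i (x ord0 i)] =
  (\big[*%E/1]_(i < n) lebesgue_measure (A i))%E.
Proof.
elim: n A => [|n IHn] A mA /=.
  by rewrite big_ord0 diracE mem_set//= => -[].
rewrite /lebesgue_cons /pushforward big_ord_recl.
rewrite -IHn => [|i]; last exact: mA.
rewrite -product_measure1E; [|exact: mA|]; last first.
  rewrite [X in measurable X](_ : _ =
      \bigcap_(i in [set: 'I_n]) (fun x : 'rV[R]_n => x ord0 i) @^-1`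
        A (lift ord0 i)); last first.
    by apply/seteqP; split => [x xA i _|x xA i]; exact: xA.
  apply: fin_bigcap_measurable => // i _.
  rewrite -[X in measurable X]setTI.
  exact: (measurable_coord i measurableT (mA _)).
congr ((_ \x _)%E _); apply/seteqP; split => [p pA|p [/= p1 p2] i].
  split => [|i]/=; first by have := pA ord0; rewrite row_cons0.
  by have := pA (lift ord0 i); rewrite row_consS.
by case: (unliftP ord0 i) => [j|] ->; rewrite ?row_consS ?row_cons0.
Qed.

End lebesgue.

(* Caratheodory extension of the Borel measure: its measurable sets are the
   Lebesgue measurable ones, and it takes outer-measure values elsewhere. *)
Definition lebesgue_rV {R : realType} n :=
  @completed_measure_extension _ _ _ (@borel_lebesgue R n).

Definition lebesgue_measurable {R : realType} n : set (set 'rV[R]_n) :=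
  ((borel_lebesgue n)^*)%mu.-cara.-measurable.

Lemma lebesgue_rVE {R : realType} n (A : set 'rV[R]_n) :
  measurable A -> lebesgue_rV A = borel_lebesgue n A.
Proof. exact: (@measurable_mu_extE _ _ _ (borel_lebesgue n)). Qed.

Section euclidean.
Context {R : realType} {n : nat}.
Implicit Types (x y : 'rV[R]_n) (X : set 'rV[R]_n).

Definition dotv x y : R := (x *m y^T) ord0 ord0.

Definition enorm x : R := Num.sqrt (dotv x x).

Definition oball (r : R) : set 'rV[R]_n := [set x | enorm x < r].

(* X^star. The radius exists when X has finite measure and n > 0, and is then
   unique; oball 0 is empty. *)
Definition rearrangement X : set 'rV[R]_n :=
  oball (get [set r | 0 <= r /\ lebesgue_rV (oball r) = lebesgue_rV X]).

(* Steiner symmetrization along the line spanned by e, which must be a unit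
   vector for s |-> x + s *: e to preserve length. This fixes a representative:
   sections that are not Lebesgue measurable get their outer measure. *)
Definition steiner_unit (e : 'rV[R]_n) X : set 'rV[R]_n :=
  [set y | exists x t, [/\ dotv x e = 0, y = x + t *: e &
    ((2 * `|t|)%:E <
       completed_lebesgue_measure [set s : R | X (x + s *: e)%R])%E]].

End euclidean.

Section projective_space.
Variables (R : realType) (n : nat).

Definition nonzero : set 'rV[R]_n.+1 := [set v | v != 0].

Let nonzero_ex : exists v : 'rV[R]_n.+1, v \in nonzero.
Proof.
exists (const_mx 1); apply/mem_set => /=.
by apply/eqP => /rowP/(_ ord0); rewrite !mxE => /eqP; rewrite oner_eq0.
Qed.

HB.instance Definition _ := isPointed.Build nonzero
  (exist _ _ (svalP (cid nonzero_ex))).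

(* equality of row spaces, i.e. of the lines spanned by v and w *)
Definition same_line (v w : nonzero) : bool := (set_val v == set_val w)%MS.

Let same_line_refl : reflexive same_line.
Proof. by move=> v; rewrite /same_line submx_refl. Qed.

Let same_line_sym : symmetric same_line.
Proof. by move=> v w; rewrite /same_line andbC. Qed.

Let same_line_trans : transitive same_line.
Proof.
move=> w v x /eqmxP vw /eqmxP wx; apply/eqmxP.
exact: eqmx_trans vw wx.
Qed.

Canonical same_line_equiv :=
  EquivRel same_line same_line_refl same_line_sym same_line_trans.

Definition projective_space :=
  quotient_topology {eq_quot same_line}%qT.

HB.instance Definition _ := PointedTopological.on projective_space.
HB.instance Definition _ := Quotient.on projective_space.

HB.instance Definition _ := Measurable.copy projective_space
  (g_sigma_algebraType (@open projective_space)).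

(* defined up to sign, which does not affect steiner_unit *)
Definition unit_dir (u : projective_space) : 'rV[R]_n.+1 :=
  let v := set_val (repr u) in (enorm v)^-1 *: v.

Definition steiner (u : projective_space) (X : set 'rV[R]_n.+1) :=
  steiner_unit (unit_dir u) X.

(* X^(s_1 ... s_k) for s = [:: s_1; ...; s_k] *)
Definition steiner_seq (X : set 'rV[R]_n.+1) (s : seq projective_space) :=
  foldl (fun Y u => steiner u Y) X s.

End projective_space.

Definition mutually_independent d d' (Omega : measurableType d)
    (T : measurableType d') (R : realType) (P : probability Omega R)
    (I : choiceType) (S : I -> {RV P >-> T}) :=
  forall (J : {fset I}) (B : I -> set T),
    (forall i, i \in J -> measurable (B i)) ->
    P (\bigcap_(i in [set` J]) S i @^-1` B i) =
    (\prod_(i <- J) P (S i @^-1` B i))%E.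

(* Main.v *)
Require Import Defs.
From HB Require Import structures.
From mathcomp Require Import all_boot all_order all_algebra finmap.
From mathcomp Require Import all_classical all_reals all_analysis.
From mathcomp Require Import measurable_realfun ring lra.

Set Implicit Arguments.
Unset Strict Implicit.
Unset Printing Implicit Defensive.
Import Order.TTheory GRing.Theory Num.Theory.
Import numFieldNormedType.Exports.

Local Open Scope classical_set_scope.
Local Open Scope ring_scope.

(** Write [m] for Lebesgue measure, [d(X, Y)] for the measure of the symmetric
difference, [B(X)] for the rearrangement of [X] and [X^u] for its symmetrization along
[u]. Every symmetrization contracts [d] and fixes the balls around the origin, so that
[d(X_k, B(X))] decreases along the random sequence [X_k] of images of [X].

If almost no direction moves [X], then almost surely [X_k = X] up to null sets, so
that [X_k] cannot converge to [B(X)] unless [X = B(X)]. To speak of the measure of the set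
of directions that move [X] one needs that it is open, which follows from the
continuity of [u |-> X^u] ([steiner_continuous], [open_steiner]).

The converse rests on a compactness argument. By density ([good_dense]) one may take
[X] bounded with [m(thick h X)] tending to [m X] as [h] tends to [0]. Symmetrization
decreases the measure of thickenings ([thick_steiner_sub]), so that the orbit of [X]
under all finite words of directions is totally bounded, hence precompact
([orbit_totally_bounded], [ultra_orbit_limit]). The measures of the traces on the balls
around the origin all increase under symmetrization, and a weighted sum of them, the
energy, increases strictly unless [X^u = X] ([energy_steiner_eq]). Consider words with
letters in the support of [mu]. A limit [Z] of images of [X] under such words, along
which the energy tends to its supremum, is fixed by every direction of the support. If
[Z] differed from [B(Z)], the set of directions that move [Z] would be open and not null,
and would meet the support because the projective space is compact
([ex_charged_moved]). So [Z = B(Z) = B(X)], and some word brings [X] close to [B(X)]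
([charged_approach]). By total boundedness one word serves the whole orbit, and by
continuity its letters may range over open sets of positive measure
([ex_rounding_opens]). Independence implies that almost surely some block of
consecutive random directions falls into these open sets ([ae_hit_block]); from there
on [X_k] is close to [B(X)], as the distance decreases.

That symmetrization along an arbitrary direction is measurable and keeps the measure
is reduced by a reflection to the first axis, where it is Tonelli's theorem. The
invariance of the measure under reflections comes from a convolution identity
([borel_lebesgue_linear]) applied to a ball. *)

(** * Euclidean geometry of row vectors *)

Section euclidean_geometry.
Context {R : realType} {n : nat}.
Implicit Types (x y z w e : 'rV[R]_n) (a r : R).

Lemma dotvE x y : dotv x y = \sum_i x ord0 i * y ord0 i.
Proof. by rewrite /dotv mxE; apply: eq_bigr => i _; rewrite mxE. Qed.

Lemma dotvC x y : dotv x y = dotv y x.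
Proof. by rewrite !dotvE; apply: eq_bigr => i _; rewrite mulrC. Qed.

Lemma dotvDl x y z : dotv (x + y) z = dotv x z + dotv y z.
Proof. by rewrite /dotv mulmxDl mxE. Qed.

Lemma dotvZl a x y : dotv (a *: x) y = a * dotv x y.
Proof. by rewrite /dotv -scalemxAl mxE. Qed.

Lemma dotvNl x y : dotv (- x) y = - dotv x y.
Proof. by rewrite -scaleN1r dotvZl mulN1r. Qed.

Lemma dotvDr x y z : dotv x (y + z) = dotv x y + dotv x z.
Proof. by rewrite dotvC dotvDl !(dotvC x). Qed.

Lemma dotvZr a x y : dotv x (a *: y) = a * dotv x y.
Proof. by rewrite dotvC dotvZl dotvC. Qed.

Lemma dotvNr x y : dotv x (- y) = - dotv x y.
Proof. by rewrite dotvC dotvNl dotvC. Qed.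

Definition dotv_lin := (dotvDl, dotvDr, dotvZl, dotvZr, dotvNl, dotvNr).

Lemma dotv_ge0 x : 0 <= dotv x x.
Proof. by rewrite dotvE; apply: sumr_ge0 => i _; rewrite -expr2 sqr_ge0. Qed.

Lemma dotv_eq0 x : (dotv x x == 0) = (x == 0).
Proof.
apply/idP/idP => [|/eqP->]; last by rewrite dotvE big1// => i _; rewrite mxE mul0r.
rewrite dotvE psumr_eq0 => [/allP x0|i _]; last by rewrite -expr2 sqr_ge0.
apply/eqP/rowP => i; rewrite mxE.
by have := x0 i; rewrite mem_index_enum -expr2 sqrf_eq0 => /(_ isT)/eqP.
Qed.

Lemma enorm_ge0 x : 0 <= enorm x.
Proof. exact: sqrtr_ge0. Qed.

Lemma sqr_enorm x : enorm x ^+ 2 = dotv x x.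
Proof. by rewrite sqr_sqrtr// dotv_ge0. Qed.

Lemma enorm_eq0 x : (enorm x == 0) = (x == 0).
Proof. by rewrite -[LHS]sqrf_eq0 sqr_enorm dotv_eq0. Qed.

Lemma enorm_gt0 x : (0 < enorm x) = (x != 0).
Proof. by rewrite lt0r enorm_ge0 andbT enorm_eq0. Qed.

Lemma enorm0 : enorm (0 : 'rV[R]_n) = 0.
Proof. by apply/eqP; rewrite enorm_eq0. Qed.

Lemma enormZ a x : enorm (a *: x) = `|a| * enorm x.
Proof.
by rewrite /enorm dotvZl dotvZr mulrA -expr2 sqrtrM ?sqr_ge0// sqrtr_sqr.
Qed.

Lemma enormN x : enorm (- x) = enorm x.
Proof. by rewrite -scaleN1r enormZ normrN1 mul1r. Qed.

Lemma ltr_enorm x r : 0 <= r -> (enorm x < r) = (dotv x x < r ^+ 2).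
Proof. by move=> r0; rewrite -sqr_enorm ltr_pXn2r// ?nnegrE ?enorm_ge0. Qed.

Lemma ler_enorm x r : 0 <= r -> (enorm x <= r) = (dotv x x <= r ^+ 2).
Proof. by move=> r0; rewrite -sqr_enorm ler_pXn2r// ?nnegrE ?enorm_ge0. Qed.

Lemma le_dotv_enorm x y : `|dotv x y| <= enorm x * enorm y.
Proof.
have [->|y0] := eqVneq y 0.
  by rewrite /dotv trmx0 mulmx0 mxE normr0 mulr_ge0// enorm_ge0.
rewrite -[leRHS]ger0_norm ?mulr_ge0 ?enorm_ge0// -ler_sqr ?nnegrE ?normr_ge0//.
rewrite !real_normK ?num_real// exprMn !sqr_enorm.
have := dotv_ge0 (dotv y y *: x - dotv x y *: y).
rewrite !dotv_lin (dotvC y x) => h.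
have y_gt0 : 0 < dotv y y by rewrite lt0r dotv_ge0 dotv_eq0 y0.
by rewrite -(ler_pM2l y_gt0); nra.
Qed.

Lemma enormD x y : enorm (x + y) <= enorm x + enorm y.
Proof.
rewrite ler_enorm ?addr_ge0 ?enorm_ge0// !dotv_lin (dotvC y x) sqrrD !sqr_enorm.
by have := le_trans (ler_norm _) (le_dotv_enorm x y); lra.
Qed.

Lemma enormB x y : enorm (x - y) = enorm (y - x).
Proof. by rewrite -enormN opprB. Qed.

Lemma coord_le_enorm x i : `|x ord0 i| <= enorm x.
Proof.
rewrite -(@ler_pXn2r _ 2) ?nnegrE ?enorm_ge0// sqr_enorm dotvE.
rewrite real_normK ?num_real// (bigD1 i)//= -expr2 lerDl.
by apply: sumr_ge0 => j _; rewrite -expr2 sqr_ge0.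
Qed.

Lemma enorm_le_coord x r :
  0 <= r -> (forall i, `|x ord0 i| <= r) -> enorm x <= n%:R * r.
Proof.
move=> r0 xr; have [->|/eqP x0] := eqVneq x 0; first by rewrite enorm0 mulr_ge0.
have n0 : (0 < n)%N.
  by case: n x xr x0 => // x _ []; apply/rowP => -[].
rewrite ler_enorm ?mulr_ge0// dotvE.
apply: (@le_trans _ _ (\sum_(i < n) r ^+ 2)).
  apply: ler_sum => i _; rewrite -expr2 -[leLHS]real_normK ?num_real//.
  by rewrite ler_pXn2r// nnegrE.
rewrite sumr_const card_ord -[leLHS]mulr_natl exprMn ler_wpM2r ?sqr_ge0//.
by rewrite expr2 ler_peMl// ler1n.
Qed.

(** Reflection in the hyperplane orthogonal to [w]. Since [a / 0 = 0], it is the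
identity when [w = 0], so that the lemmas below hold for every [w]. *)
Definition reflection w x : 'rV[R]_n := x - (2 * dotv x w / dotv w w) *: w.

Lemma dotv_divK w x : dotv w w * (dotv x w / dotv w w) = dotv x w.
Proof.
have [->|w0] := eqVneq w 0; first by rewrite /dotv trmx0 !mulmx0 mxE !mul0r.
by rewrite mulrC divfK// dotv_eq0.
Qed.

Lemma dotv_reflection w x y : dotv (reflection w x) (reflection w y) = dotv x y.
Proof.
rewrite /reflection -!mulrA !dotv_lin (dotvC w y).
have := dotv_divK w x; have := dotv_divK w y.
set a := dotv x w / _; set b := dotv y w / _ => <- <-; ring.
Qed.

Lemma enorm_reflection w x : enorm (reflection w x) = enorm x.
Proof. by rewrite /enorm dotv_reflection. Qed.

Lemma reflectionD w x y : reflection w (x + y) = reflection w x + reflection w y.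
Proof. by apply/rowP => i; rewrite /reflection !dotv_lin !mxE; ring. Qed.

Lemma reflectionZ w a x : reflection w (a *: x) = a *: reflection w x.
Proof. by apply/rowP => i; rewrite /reflection !dotv_lin !mxE; ring. Qed.

Lemma reflectionN w x : reflection w (- x) = - reflection w x.
Proof. by rewrite -scaleN1r reflectionZ scaleN1r. Qed.

Lemma reflectionB w x y : reflection w (x - y) = reflection w x - reflection w y.
Proof. by rewrite reflectionD reflectionN. Qed.

Lemma reflectionK w : involutive (reflection w).
Proof.
move=> x; have h := dotv_divK w x; rewrite /reflection -!mulrA !dotv_lin.
set a := dotv x w / _ in h *.
have -> : (dotv x w - 2 * a * dotv w w) / dotv w w = - a.
  rewrite -h; have [w0|w0] := eqVneq (dotv w w) 0; last by field.
  by rewrite /a w0 invr0 !mulr0 oppr0.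
by apply/rowP => i; rewrite !mxE; ring.
Qed.

Lemma reflection_swap e f : dotv e e = dotv f f -> reflection (e - f) e = f.
Proof.
move=> ef; have [w0|w0] := eqVneq (dotv (e - f) (e - f)) 0.
  move/eqP: (w0); rewrite dotv_eq0 subr_eq0 => /eqP <-.
  by rewrite /reflection subrr scaler0 subr0.
rewrite /reflection (_ : 2 * _ / _ = 1) ?scale1r ?subKr//.
rewrite (_ : 2 * _ = dotv (e - f) (e - f)) ?divff// !dotv_lin ef (dotvC f e).
by ring.
Qed.

End euclidean_geometry.

(** * Translations and linear bijections acting on the Borel measure *)

Section borel_measure.
Context {R : realType}.
Local Notation leb := (@lebesgue_measure R).
Local Notation bl := (@borel_lebesgue R).

Lemma lebesgue_measure_translate (a : R) (A : set (measurableTypeR R)) :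
  measurable A ->
  leb ((fun x : measurableTypeR R => x + a : measurableTypeR R) @^-1` A) = leb A.
Proof.
have ma : measurable_fun setT (fun x : measurableTypeR R => x + a : measurableTypeR R).
  exact: measurable_funD.
move=> mA; apply/esym.
pose m := pushforward leb (fun x : measurableTypeR R => x + a : measurableTypeR R).
rewrite -[RHS]/(m A); apply: lebesgue_measure_unique => //= _ [[x y]] _ <-.
rewrite /m /pushforward (_ : _ @^-1` _ = `]x - a, y - a]%classic); last first.
  by apply/seteqP; split => z /=; rewrite !in_itv/= ltrBlDr lerBrDr.
rewrite !lebesgue_measure_itv/= !lte_fin ltrD2r; case: ifP => // _.
by rewrite -!EFinD; congr EFin; ring.
Qed.

Lemma measurable_fun_coord d (T : measurableType d) n (f : T -> 'rV[R]_n) i :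
  measurable_fun setT f -> measurable_fun setT (fun t => f t ord0 i).
Proof. by move=> mf; apply: (measurableT_comp (measurable_coord i) mf). Qed.

Lemma measurable_funD_row d (T : measurableType d) n (f g : T -> 'rV[R]_n) :
  measurable_fun setT f -> measurable_fun setT g ->
  measurable_fun setT (fun t => f t + g t).
Proof.
move=> mf mg; apply: measurable_fun_row => i.
under eq_fun do rewrite mxE.
by apply: measurable_funD; exact: measurable_fun_coord.
Qed.

Lemma measurable_funZ_row d (T : measurableType d) n (a : T -> R) (g : T -> 'rV[R]_n) :
  measurable_fun setT a -> measurable_fun setT g ->
  measurable_fun setT (fun t => a t *: g t).
Proof.
move=> ma mg; apply: measurable_fun_row => i.
under eq_fun do rewrite mxE.
by apply: measurable_funM => //; exact: measurable_fun_coord.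
Qed.

Lemma measurable_fun_dotv d (T : measurableType d) n (f g : T -> 'rV[R]_n) :
  measurable_fun setT f -> measurable_fun setT g ->
  measurable_fun setT (fun t => dotv (f t) (g t)).
Proof.
move=> mf mg; under eq_fun do rewrite dotvE.
apply: measurable_sum => i.
by apply: measurable_funM; exact: measurable_fun_coord.
Qed.

Lemma measurable_reflection n (w : 'rV[R]_n) : measurable_fun setT (reflection w).
Proof.
rewrite /reflection; apply: measurable_funD_row => //.
under eq_fun do rewrite -scaleNr.
apply: measurable_funZ_row => //; apply: measurable_funN.
apply: measurable_funM => //; apply: measurable_funM => //.
exact: measurable_fun_dotv.
Qed.

Lemma measurable_oball n (r : R) : measurable (oball r : set 'rV[R]_n).
Proof.
have [r0|r0] := leP 0 r; last first.
  rewrite (_ : oball r = set0)//; apply/seteqP; split => // x /=.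
  by rewrite /oball/= => xr; have := lt_trans xr r0; rewrite ltNge enorm_ge0.
rewrite (_ : oball r = (fun x => dotv x x) @^-1` `]-oo, r ^+ 2[%classic).
  rewrite -[X in measurable X]setTI.
  by apply: (measurable_fun_dotv (@measurable_id _ _ _) (@measurable_id _ _ _)).
by apply/seteqP; split => x /=; rewrite /oball in_itv/= ltr_enorm.
Qed.

Lemma measurable_preimage d d' (T : measurableType d) (U : measurableType d')
    (f : T -> U) A :
  measurable_fun setT f -> measurable A -> measurable (f @^-1` A).
Proof. by move=> mf mA; rewrite -[X in measurable X]setTI; exact: mf. Qed.

Lemma measurable_box n (A : 'I_n -> set R) : (forall i, measurable (A i)) ->
  measurable [set x : 'rV[R]_n | forall i, A i (x ord0 i)].
Proof.
move=> mA; rewrite [X in measurable X](_ : _ =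
    \bigcap_(i in [set: 'I_n]) (fun x : 'rV[R]_n => x ord0 i) @^-1` A i); last first.
  by apply/seteqP; split => [x xA i _|x xA i]; exact: xA.
apply: fin_bigcap_measurable => // i _.
by apply: measurable_preimage => //; exact: measurable_coord.
Qed.

(** Induction on the dimension: on measurable rectangles the identity is the one
for each factor, and a measure on a product is determined by its values there. *)
Lemma borel_lebesgue_translate n (v : 'rV[R]_n) A : measurable A ->
  bl n ((fun x => x + v) @^-1` A) = bl n A.
Proof.
elim: n v A => [|n IH] v A mA.
  rewrite (_ : _ @^-1` A = A)//; apply/seteqP.
  have E (x : 'rV[R]_0) : x + v = x by apply/rowP => -[].
  by split => x /=; rewrite E.
pose w := \row_i v ord0 (lift ord0 i).
pose tau (p : measurableTypeR R * 'rV[R]_n) : measurableTypeR R * 'rV[R]_n :=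
  (p.1 + v ord0 ord0, p.2 + w).
have mtau : measurable_fun setT tau.
  apply/measurable_fun_pairP; split.
    by apply: measurable_funD => //; exact: measurable_fst.
  by apply: measurable_funD_row => //; exact: measurable_snd.
have mcA : measurable (@row_cons R n @^-1` A : set (measurableTypeR R * 'rV[R]_n)).
  exact: (measurable_preimage (@measurable_row_cons _ _)).
rewrite /= /lebesgue_cons /pushforward.
have E p : @row_cons R n (tau p) = row_cons p + v.
  apply/rowP => i; rewrite [RHS]mxE.
  by case: (unliftP ord0 i) => [j|] ->; rewrite ?row_consS ?row_cons0 /tau//= !mxE.
have -> : @row_cons R n @^-1` ((fun x => x + v) @^-1` A) =
    tau @^-1` (@row_cons R n @^-1` A).
  by apply/seteqP; split => p; rewrite /preimage/= E.
rewrite -[LHS]/(pushforward (leb \x bl n)%E tau (@row_cons R n @^-1` A)).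
apply/esym/product_measure_unique => //= B C mB mC.
rewrite /pushforward (_ : tau @^-1` _ =
  ((fun x : measurableTypeR R => x + v ord0 ord0 : measurableTypeR R) @^-1` B)
  `*` ((fun x => x + w) @^-1` C)); last by apply/seteqP; split.
rewrite product_measure1E ?IH//.
- by congr (_ * _)%E; exact: lebesgue_measure_translate.
- apply: measurable_preimage mB.
  by apply: (@measurable_funD _ (measurableTypeR R)).
- by apply: measurable_preimage => //; exact: measurable_funD_row.
Qed.

(** Tonelli on the set of pairs [(x, y)] with [x + L y \in A] and [y \in B]:
translating [x] makes its measure [bl A * bl B], while replacing [y] by
[y - K x], with [K] the inverse of [L], and then translating and reflecting [x]
gives the right-hand side. As [B] is free, this computes the image of [bl] by any
[L] that has one symmetric set whose image is known. *)
Lemma borel_lebesgue_linear n (L K : 'rV[R]_n -> 'rV[R]_n) (A B : set 'rV[R]_n) :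
  measurable_fun setT L -> measurable_fun setT K ->
  {morph K : x y / x - y} -> cancel L K -> cancel K L ->
  measurable A -> measurable B -> -%R @^-1` B = B ->
  (bl n A * bl n B = bl n (L @^-1` A) * bl n (K @^-1` B))%E.
Proof.
move=> mL mK KB LK KL mA mB BN.
have LD x y : L (x + y) = L x + L y.
  apply: (can_inj KL); rewrite LK.
  have K0 : K 0 = 0 by rewrite -[X in K X](subrr 0) KB subrr.
  have KN z : K (- z) = - K z by rewrite -sub0r KB K0 sub0r.
  by rewrite -[L y]opprK KB KN opprK !LK.
have mfst := @measurable_fst _ _ 'rV[R]_n 'rV[R]_n.
have msnd := @measurable_snd _ _ 'rV[R]_n 'rV[R]_n.
pose E := [set p : 'rV[R]_n * 'rV[R]_n | A (p.1 + L p.2) /\ B p.2].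
pose E' := [set p : 'rV[R]_n * 'rV[R]_n | A (L p.2) /\ B (p.2 - K p.1)].
have mE : measurable E.
  rewrite (_ : E = (fun p => p.1 + L p.2) @^-1` A `&` snd @^-1` B)//.
  apply: measurableI; apply: measurable_preimage => //.
  by apply: measurable_funD_row => //; exact: (measurableT_comp mL msnd).
have mE' : measurable E'.
  rewrite (_ : E' = (L \o snd) @^-1` A `&`
    (fun p => p.2 + (-1) *: K p.1) @^-1` B).
    apply: measurableI; apply: measurable_preimage => //.
      exact: (measurableT_comp mL msnd).
    apply: measurable_funD_row => //; apply: measurable_funZ_row => //.
    exact: (measurableT_comp mK mfst).
  by apply/seteqP; split => p; rewrite /E'/= ?scaleN1r//.
have swap F : measurable F -> (bl n \x bl n)%E F = (bl n \x^ bl n)%E F.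
  move=> mF; apply: product_measure_unique => // X Y mX mY.
  exact: product_measure2E.
have -> : (bl n A * bl n B)%E = (bl n \x^ bl n)%E E.
  rewrite /product_measure2 (eq_integral (fun y => (bl n A * (\1_B y)%:E)%E)).
    rewrite ge0_integralZl ?integral_indic ?setIT//.
    exact: measurableT_comp.
  move=> y _; rewrite indicE /=.
  have [yB|yB] := boolP (y \in B).
    rewrite mule1 -(borel_lebesgue_translate (L y) mA); congr (bl n _).
    apply/seteqP; split => x /=; rewrite /ysection/= inE => //.
      by move=> -[].
    by move=> ?; split => //; rewrite inE in yB.
  rewrite mule0 (_ : ysection E y = set0) ?measure0//.
  apply/seteqP; split => x //=; rewrite /ysection/= inE => -[_ By].
  by rewrite notin_setE in yB.
rewrite -swap//.
have -> : (bl n \x bl n)%E E = (bl n \x bl n)%E E'.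
  rewrite /product_measure1; apply: eq_integral => x _ /=.
  rewrite -[RHS](borel_lebesgue_translate (K x)); last exact: measurable_xsection.
  congr (bl n _); apply/seteqP; split => y /=; rewrite /xsection/= !inE /E /E'/=.
    by rewrite LD KL addrK (addrC x).
  by rewrite LD KL addrK (addrC x).
rewrite swap// /product_measure2.
rewrite (eq_integral (fun y => (bl n (K @^-1` B) * (\1_(L @^-1` A) y)%:E)%E)).
  have mLA : measurable (L @^-1` A) by exact: (measurable_preimage mL).
  rewrite ge0_integralZl ?integral_indic ?setIT// 1?muleC//.
  exact: measurableT_comp.
move=> y _; rewrite indicE /=.
have mKB : measurable (K @^-1` B) by exact: (measurable_preimage mK).
have [yA|yA] := boolP (y \in L @^-1` A).
  rewrite mule1 -(borel_lebesgue_translate (- L y) mKB); congr (bl n _).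
  rewrite inE in yA.
  have BNE z : B (- z) = B z by rewrite -[in RHS]BN.
  apply/seteqP; split => x /=; rewrite /ysection/= inE /E'/= KB LK -BNE opprB => //.
  by move=> -[].
rewrite mule0 (_ : ysection E' y = set0) ?measure0//.
apply/seteqP; split => x //=; rewrite /ysection/= inE => -[Ay _].
by rewrite notin_setE in yA.
Qed.

End borel_measure.

(** * Measures of balls; invariance under reflections *)

Section ball_measure.
Context {R : realType}.
Local Notation leb := (@lebesgue_measure R).
Local Notation bl := (@borel_lebesgue R).

Definition cube n (c : R) : set 'rV[R]_n := [set x | forall i, `|x ord0 i| < c].

Lemma cubeE n c : cube c = [set x : 'rV[R]_n | forall i, `]- c, c[%classic (x ord0 i)].
Proof.
by apply/seteqP; split => x xc i; have := xc i; rewrite /= in_itv/= ltr_norml.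
Qed.

Lemma borel_lebesgue_cube n (c : R) : 0 <= c ->
  bl n (cube c) = ((c *+ 2) ^+ n)%:E.
Proof.
move=> c0; rewrite cubeE (@borel_lebesgue_box R n (fun=> `]- c, c[%classic))//.
have -> : leb `]- c, c[%classic = (c *+ 2)%:E.
  rewrite lebesgue_measure_itv/= lte_fin; case: ltP => h.
    by rewrite -EFinD opprK mulr2n.
  by congr EFin; lra.
by elim: n => [|n IH]; rewrite ?big_ord0// big_ord_recl IH -EFinM exprS.
Qed.

Lemma measurable_cube n c : measurable (cube c : set 'rV[R]_n).
Proof.
by rewrite cubeE; exact: (measurable_box (A := fun=> _) (fun=> measurable_itv _)).
Qed.

Lemma oball_sub_cube n (r : R) : oball r `<=` (cube r : set 'rV[R]_n).
Proof. by move=> x xr i; apply: le_lt_trans (coord_le_enorm x i) xr. Qed.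

Lemma borel_lebesgue_oball_lty n (r : R) : (bl n (oball r) < +oo)%E.
Proof.
apply: (@le_lt_trans _ _ (bl n (cube `|r|))).
  apply: le_measure; rewrite ?inE; [exact: measurable_oball|exact: measurable_cube|].
  by apply: subset_trans (@oball_sub_cube _ _) => x /lt_le_trans; apply; exact: ler_norm.
by rewrite borel_lebesgue_cube// ltry.
Qed.

Lemma borel_lebesgue_oball_gt0 n (r : R) : 0 < r -> (0 < bl n (oball r))%E.
Proof.
move=> r0; pose c := r / n.+1%:R; have c0 : 0 < c by rewrite divr_gt0.
apply: (@lt_le_trans _ _ (bl n (cube c))).
  by rewrite borel_lebesgue_cube ?ltW// lte_fin exprn_gt0// mulrn_wgt0.
apply: le_measure; rewrite ?inE; [exact: measurable_cube|exact: measurable_oball|].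
move=> x xc; rewrite /oball/=; apply: (@le_lt_trans _ _ (n%:R * c)).
  by apply: enorm_le_coord => [|i]; rewrite ltW.
rewrite /c mulrCA gtr_pMr// ltr_pdivrMr ?mul1r ?ltr_nat//.
Qed.

Lemma oballZ n (s : R) : 0 < s -> (fun x : 'rV[R]_n => s^-1 *: x) @^-1` oball 1 = oball s.
Proof.
move=> s0; apply/seteqP; split => x; rewrite /oball/= enormZ gtr0_norm ?invr_gt0//;
  by rewrite mulrC ltr_pdivrMr// mul1r.
Qed.

Lemma oballN n (r : R) : -%R @^-1` oball r = oball r :> set 'rV[R]_n.
Proof. by apply/seteqP; split => x; rewrite /oball/= enormN. Qed.

(** The unit ball is compared with a cube, whose dilates are known. *)
Lemma borel_lebesgue_oball n (r : R) : 0 < r ->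
  bl n (oball r) = ((r ^+ n)%:E * bl n (oball 1))%E.
Proof.
move=> r0; have rn0 : r != 0 by rewrite gt_eqF.
have mZ a : measurable_fun setT (fun x : 'rV[R]_n => a *: x).
  exact: measurable_funZ_row.
have := @borel_lebesgue_linear R n ( *:%R r) ( *:%R r^-1) (cube r) (oball 1)
  (mZ _) (mZ _) (scalerBr _) (scalerK rn0) (scalerKV rn0)
  (@measurable_cube _ _) (@measurable_oball _ _ _) (oballN _ _).
rewrite oballZ// (_ : _ @^-1` cube r = cube 1); last first.
  have E a : (`|r * a| < r) = (`|a| < 1).
    by rewrite normrM gtr0_norm// gtr_pMr.
  by apply/seteqP; split => x xr i; have := xr i; rewrite mxE E.
rewrite !borel_lebesgue_cube ?ltW// -[r *+ 2]mulr_natr exprMn EFinM.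
move=> /(congr1 (fun x : \bar R => (2 ^+ n)^-1%:E * x)%E).
have c : ((2 ^+ n)^-1%:E * (2 ^+ n)%:E)%E = 1%E :> \bar R.
  by rewrite -EFinM mulVf// expf_neq0.
by rewrite [((r ^+ n)%:E * (2 ^+ n)%:E)%E]muleC !muleA c !mul1e => ->.
Qed.

(** The measure of a ball is a power of its radius, which is solved for. *)
Lemma ex_oball n (a : \bar R) : (0 <= a < +oo)%E ->
  exists2 r, 0 <= r & bl n.+1 (oball r) = a.
Proof.
move=> /andP[a0 aoo]; have afin : a \is a fin_num by rewrite ge0_fin_numE.
have [a_eq0|a_neq0] := eqVneq a 0%E.
  exists 0 => //; rewrite a_eq0 (_ : oball 0 = set0) ?measure0//.
  by apply/seteqP; split => // x; rewrite /oball/= ltNge enorm_ge0.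
have b0 := @borel_lebesgue_oball_gt0 n.+1 1 ltr01.
have bfin : bl n.+1 (oball 1) \is a fin_num.
  by rewrite ge0_fin_numE// borel_lebesgue_oball_lty.
set b := bl n.+1 (oball 1) in b0 bfin.
have fa0 : 0 < fine a by rewrite fine_gt0// aoo lt0e a_neq0 a0.
have fb0 : 0 < fine b by rewrite fine_gt0// b0 -ge0_fin_numE ?ltW.
pose r := (fine a / fine b) `^ n.+1%:R^-1.
have r0 : 0 < r by rewrite powR_gt0// divr_gt0.
exists r; first exact: ltW.
rewrite borel_lebesgue_oball// -/b -powR_mulrn ?ltW// -powRrM mulVf ?pnatr_eq0//.
by rewrite powRr1 ?divr_ge0 ?ltW// -(fineK bfin) -EFinM divfK ?gt_eqF// fineK.
Qed.

(** [borel_lebesgue_linear] with [B] the unit ball, which the reflection keeps. *)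
Lemma borel_lebesgue_reflection n (w : 'rV[R]_n) A : measurable A ->
  bl n (reflection w @^-1` A) = bl n A.
Proof.
move=> mA; have mr := measurable_reflection w.
have b0 := @borel_lebesgue_oball_gt0 n 1 ltr01.
have bfin : bl n (oball 1) \is a fin_num.
  by rewrite ge0_fin_numE// borel_lebesgue_oball_lty.
have := borel_lebesgue_linear mr mr (reflectionB w) (reflectionK w) (reflectionK w)
  mA (@measurable_oball _ _ 1) (oballN _ 1).
rewrite (_ : _ @^-1` oball 1 = oball 1); last first.
  by apply/seteqP; split => x; rewrite /oball/= enorm_reflection.
set b := bl n (oball 1) in b0 bfin *.
have fb0 : 0 < fine b by rewrite fine_gt0// b0 -ge0_fin_numE ?ltW.
move=> /(congr1 (fun x : \bar R => x * (fine b)^-1%:E)%E).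
by rewrite -(fineK bfin) -!muleA -EFinM divff ?gt_eqF// !mule1.
Qed.

End ball_measure.

(** * The completed measure and the distance of symmetric difference *)

Section outer_lebesgue.
Context {R : realType} {n : nat}.
Implicit Types X Y Z A B : set 'rV[R]_n.
Local Notation m := (@lebesgue_rV R n).
Local Notation bl := (@borel_lebesgue R n).
Local Notation om := ((borel_lebesgue n)^*)%mu.
Local Open Scope ereal_scope.

Lemma rV_ge0 X : 0 <= m X.
Proof. exact: (outer_measure_ge0 om). Qed.

Lemma rV_set0 : m set0 = 0.
Proof. exact: (outer_measure0 om). Qed.

Lemma le_rV X Y : X `<=` Y -> m X <= m Y.
Proof. exact: (le_outer_measure om). Qed.

Lemma rV_setU X Y : m (X `|` Y) <= m X + m Y.
Proof. exact: (outer_measureU2 om). Qed.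

Lemma rV_fin_num X : m X < +oo -> m X \is a fin_num.
Proof. by move=> Xoo; rewrite ge0_fin_numE ?rV_ge0. Qed.

Lemma rV_eq0 X : m X <= 0 -> m X = 0.
Proof. by move=> X0; apply/eqP; rewrite eq_le X0 rV_ge0. Qed.

Lemma rV_setIC X Y : lebesgue_measurable X -> m Y = m (Y `&` X) + m (Y `\` X).
Proof. by move=> mX; exact: mX. Qed.

Lemma rV_setD X Y : lebesgue_measurable X -> X `<=` Y -> m Y = m X + m (Y `\` X).
Proof. by move=> mX XY; rewrite (rV_setIC Y mX) setIidr. Qed.

Lemma borel_lebesgue_measurable A : measurable A -> lebesgue_measurable A.
Proof. exact: caratheodory_measurable_mu_ext. Qed.

(** The intersection of countable covers whose measures approach the infimum that
defines the outer measure. *)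
Lemma ex_borel_hull X : exists H, [/\ measurable H, X `<=` H & m H = m X].
Proof.
have [Xoo|Xoo] := eqVneq (m X) +oo.
  exists setT; split => //.
  by apply/eqP; rewrite Xoo -leye_eq -Xoo; exact: le_rV.
have Xfin : m X \is a fin_num by rewrite rV_fin_num// ltey.
have cover k : exists A, [/\ measurable A, X `<=` A & m A <= m X + k.+1%:R^-1%:E].
  have k0 : (0 < k.+1%:R^-1 :> R)%R by rewrite invr_gt0.
  have [_ [F [mF XF] <-] Fk] := lb_ereal_inf_adherent k0 Xfin.
  exists (\bigcup_i F i); split => //; first exact: bigcupT_measurable.
  rewrite (le_trans _ (ltW Fk))// lebesgue_rVE; last exact: bigcupT_measurable.
  by apply: measure_sigma_subadditive => //; exact: bigcupT_measurable.
have [A AP] := choice cover.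
exists (\bigcap_k A k); split.
- by apply: bigcapT_measurable => k; case: (AP k).
- by apply: sub_bigcap => k _; case: (AP k).
apply/eqP; rewrite eq_le; apply/andP; split; last first.
  by apply: le_rV; apply: sub_bigcap => k _; case: (AP k).
apply/lee_addgt0Pr => e e0; near \oo => k.
have [_ _ Ak] := AP k.
apply: (@le_trans _ _ (m (A k))); first by apply: le_rV; exact: bigcap_inf.
rewrite (le_trans Ak)// leeD2l// lee_fin ltW//.
by near: k; exact: near_infty_natSinv_lt (PosNum e0).
Unshelve. all: by end_near. Qed.

(** A Borel hull of [X] is the upper set; removing from it a Borel hull of its
difference with [X] gives the lower one. *)
Lemma lebesgue_bracket X : lebesgue_measurable X -> m X < +oo ->
  exists A B, [/\ measurable A, measurable B, A `<=` X, X `<=` B & m (B `\` A) = 0].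
Proof.
move=> mX Xoo; have [B [mB XB BX]] := ex_borel_hull X.
have BX0 : m (B `\` X) = 0.
  have := rV_setD mX XB; rewrite BX -[LHS]adde0 => /eqP.
  rewrite eq_sym; have : m (B `\` X) \is a fin_num.
    by rewrite rV_fin_num// (le_lt_trans _ Xoo)// -BX; apply: le_rV; exact: subDsetl.
  move: (rV_fin_num Xoo); case: (m X) => // x _; case: (m _) => // y _.
  by rewrite -!EFinD eqe => /eqP/addrI ->.
have [C [mC BXC C0]] := ex_borel_hull (B `\` X).
exists (B `\` C), B; split => //; first exact: measurableD.
  by move=> x [Bx Cx]; apply: contrapT => Xx; apply: Cx; exact: BXC.
apply: rV_eq0; rewrite -BX0 -C0; apply: le_rV => x [Bx /not_andP[//|/notP]].
exact.
Qed.

Lemma lebesgue_measurable_bracket X A B : measurable A -> A `<=` X -> X `<=` B ->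
  m (B `\` A) = 0 -> lebesgue_measurable X.
Proof.
move=> mA AX XB BA0; rewrite /lebesgue_measurable.
have -> : X = A `|` (X `\` A).
  apply/seteqP; split => x => [Xx|[/AX//|[]//]].
  by have [Ax|Ax] := pselect (A x); [left|right].
apply: caratheodory_measurable_setU; first exact: borel_lebesgue_measurable.
apply: le_caratheodory_measurable => Y.
rewrite -[leRHS]add0e; apply: leeD; last first.
  by apply: (le_outer_measure om); exact: subIsetl.
by rewrite -BA0; apply: le_rV => x [_ [Xx Ax]]; split => //; exact: XB.
Qed.

Definition rV_dist X Y := m (X `+` Y).

Lemma rV_dist_ge0 X Y : 0 <= rV_dist X Y.
Proof. exact: rV_ge0. Qed.

Lemma rV_distC X Y : rV_dist X Y = rV_dist Y X.
Proof. by rewrite /rV_dist setYC. Qed.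

Lemma rV_distxx X : rV_dist X X = 0.
Proof. by rewrite /rV_dist setYK rV_set0. Qed.

Lemma rV_dist_triangle Y X Z : rV_dist X Z <= rV_dist X Y + rV_dist Y Z.
Proof.
apply: le_trans (rV_setU _ _); apply: le_rV => x.
by case=> -[? ?]; have [Yx|Yx] := pselect (Y x);
  [right; left|left; left|left; right|right; right].
Qed.

Lemma rV_distE X Y : lebesgue_measurable X ->
  rV_dist X Y = m (X `\` Y) + m (Y `\` X).
Proof.
move=> mX; rewrite /rV_dist (rV_setIC _ mX); congr (m _ + m _).
  by apply/seteqP; split => x [] => [[|[]]//|Xx Yx]; split => //; left.
by apply/seteqP; split => x [] => [[[]|]//|Yx Xx]; split => //; right.
Qed.

Lemma le_rV_dist X Y : m X <= m Y + rV_dist X Y.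
Proof.
apply: le_trans (rV_setU _ _); apply: le_rV => x Xx.
by have [Yx|Yx] := pselect (Y x); [left|right; left].
Qed.

Lemma rV_dist_lty X Y : m X < +oo -> m Y < +oo -> rV_dist X Y < +oo.
Proof.
move=> Xoo Yoo; apply: (@le_lt_trans _ _ (m X + m Y)).
  by apply: le_trans (rV_setU _ _); apply: le_rV => x [[]|[]]; [left|right].
by rewrite lte_add_pinfty.
Qed.

Lemma rV_dist_sub X Y : X `<=` Y -> rV_dist X Y = m (Y `\` X).
Proof.
move=> XY; rewrite /rV_dist; congr m; apply/seteqP; split => x; last by right.
by move=> [[Xx /(_ (XY _ Xx))]|].
Qed.

Lemma rV_dist_setIl Z X Y : rV_dist (X `&` Z) (Y `&` Z) <= rV_dist X Y.
Proof.
apply: le_rV => x [[[Xx Zx] /not_andP[]]|[[Yx Zx] /not_andP[]]]//; first by left.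
by right.
Qed.

Definition finite_lebesgue X := lebesgue_measurable X /\ m X < +oo.

End outer_lebesgue.

(** * Steiner symmetrization preserves measure *)

Section steiner_borel.
Context {R : realType}.
Local Notation leb := (@lebesgue_measure R).
Local Notation bl := (@borel_lebesgue R).

Section sections.
Context {n : nat}.
Implicit Types (X Y : set 'rV[R]_n) (e : 'rV[R]_n).

Lemma steiner_unit_sub e X Y : X `<=` Y -> steiner_unit e X `<=` steiner_unit e Y.
Proof.
move=> XY y [x [t [xe -> tX]]]; exists x, t; split => //.
apply: lt_le_trans tX _.
by apply: (le_outer_measure ((wlength idfun)^*)%mu) => s; exact: XY.
Qed.

(** A reflection is an involutive isometry, so it carries lines with their lengths
to lines with their lengths. This reduces every direction to the first axis. *)
Lemma steiner_unit_reflection w e X :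
  steiner_unit (reflection w e) X =
  reflection w @^-1` steiner_unit e (reflection w @^-1` X).
Proof.
have dotw x y : dotv x (reflection w y) = dotv (reflection w x) y.
  by rewrite -[in LHS](reflectionK w x) dotv_reflection.
apply/seteqP; split => y.
  move=> [x [t [xe -> tX]]]; exists (reflection w x), t; split.
  - by rewrite -dotw.
  - by rewrite reflectionD reflectionZ reflectionK.
  - rewrite (_ : [set s | _] = [set s | X (x + s *: reflection w e)])//.
    by apply/seteqP; split => s /=; rewrite reflectionD reflectionZ reflectionK.
move=> [x [t [xe yE tX]]]; exists (reflection w x), t; split.
- by rewrite dotw reflectionK.
- by rewrite -[LHS](reflectionK w) yE reflectionD reflectionZ.
- rewrite (_ : [set s | _] = [set s | (reflection w @^-1` X) (x + s *: e)])//.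
  by apply/seteqP; split => s /=; rewrite reflectionD reflectionZ.
Qed.

(** For arbitrary [S], whose symmetrized set is defined by outer measures: [S] has a
Borel superset of the same measure. *)
Lemma lebesgue_outer_measureN (S : set R) : leb [set s | S (- s)] = leb S.
Proof.
suff le (T : set R) : (leb [set s | T (- s)%R] <= leb T)%E.
  apply/eqP; rewrite eq_le le/= -[leLHS](_ : leb [set s | S (- - s)] = leb S).
    exact: le.
  by congr (leb _); apply/seteqP; split => s; rewrite /= opprK.
have [F [oF TF FT]] := outer_measure_Gdelta T.
have mF : measurable (\bigcap_i F i).
  by apply: bigcapT_measurable => i; exact: open_measurable.
rewrite -[leRHS]FT -(lebesgue_measureN mF).
by apply: (le_outer_measure ((wlength idfun)^*)%mu) => s; exact: TF.
Qed.

Lemma steiner_unitN e X : steiner_unit (- e) X = steiner_unit e X.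
Proof.
suff sub f : steiner_unit (- f) X `<=` steiner_unit f X.
  by apply/seteqP; split; [exact: sub|rewrite -{1}[e]opprK; exact: sub].
move=> _ [x [t [xe -> tX]]]; exists x, (- t); split.
- by apply/eqP; rewrite -oppr_eq0 -dotvNr xe.
- by rewrite scalerN scaleNr.
- rewrite normrN (_ : [set s | _] = [set s | [set r | X (x + r *: - f)] (- s)]).
    by rewrite [X in (_ < X)%E]lebesgue_outer_measureN.
  by apply/seteqP; split => s /=; rewrite scalerN scaleNr opprK.
Qed.

End sections.

Definition axis n : 'rV[R]_n.+1 := delta_mx ord0 ord0.

Lemma axis_unit n : dotv (axis n) (axis n) = 1.
Proof.
rewrite dotvE big_ord_recl !mxE eqxx mulr1 big1 ?addr0// => i _.
by rewrite !mxE mulr0.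
Qed.

Lemma dotv_axis n (x : 'rV[R]_n.+1) : dotv x (axis n) = x ord0 ord0.
Proof.
rewrite dotvE big_ord_recl !mxE eqxx mulr1 big1 ?addr0// => i _.
by rewrite !mxE mulr0.
Qed.

Lemma row_consD n (p : measurableTypeR R * 'rV[R]_n) s :
  row_cons p + s *: axis n = row_cons ((p.1 + s : measurableTypeR R), p.2).
Proof.
apply/rowP => i; rewrite [LHS]mxE [X in _ + X]mxE.
case: (unliftP ord0 i) => [j|] ->; rewrite ?row_consS ?row_cons0 mxE/=.
  by rewrite mulr0 addr0.
by rewrite mulr1.
Qed.

Definition row_uncons n (x : 'rV[R]_n.+1) : measurableTypeR R * 'rV[R]_n :=
  (x ord0 ord0, \row_i x ord0 (lift ord0 i)).

Lemma row_unconsK n (x : 'rV[R]_n.+1) : row_cons (row_uncons x) = x.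
Proof.
apply/rowP => i; case: (unliftP ord0 i) => [j|] ->.
  by rewrite row_consS mxE.
by rewrite row_cons0.
Qed.

Lemma row_consK n (p : measurableTypeR R * 'rV[R]_n) : row_uncons (row_cons p) = p.
Proof.
rewrite /row_uncons row_cons0 [p in RHS]surjective_pairing; congr (_, _).
by apply/rowP => i; rewrite mxE row_consS.
Qed.

Lemma measurable_row_uncons n : measurable_fun setT (@row_uncons n).
Proof.
apply/measurable_fun_pairP; split; first exact: measurable_coord.
apply: measurable_fun_row => i.
under eq_fun do rewrite /= mxE.
exact: measurable_coord.
Qed.

Definition axis_section n (X : set 'rV[R]_n.+1) (x : 'rV[R]_n) : \bar R :=
  leb [set s | X (row_cons (s, x))].

Lemma steiner_axisE n (X : set 'rV[R]_n.+1) p :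
  steiner_unit (axis n) X (row_cons p) <->
  ((2 * `|p.1|)%:E < axis_section X p.2)%E.
Proof.
split => [[x [t [xe px tX]]]|pX].
  have xE : x = row_cons ((0 : measurableTypeR R), p.2).
    rewrite -[x]row_unconsK; congr (row_cons (_, _)).
      by rewrite -dotv_axis.
    by rewrite -[p]row_consK px /row_uncons/=; apply/rowP => i; rewrite !mxE mulr0 addr0.
  have -> : p.1 = t.
    by rewrite -(row_cons0 p) px xE row_consD row_cons0 add0r.
  apply: lt_le_trans tX _; rewrite /axis_section.
  apply: (le_outer_measure ((wlength idfun)^*)%mu) => s /=.
  by rewrite xE row_consD add0r.
exists (row_cons ((0 : measurableTypeR R), p.2)), p.1; split.
- by rewrite dotv_axis row_cons0.
- by rewrite row_consD add0r -surjective_pairing.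
- apply: lt_le_trans pX _; rewrite /axis_section.
  apply: (le_outer_measure ((wlength idfun)^*)%mu) => s /=.
  by rewrite row_consD add0r.
Qed.

Lemma measurable_axis_section n (A : set 'rV[R]_n.+1) : measurable A ->
  measurable_fun setT (axis_section A).
Proof.
move=> mA; have mcA : measurable (@row_cons R n @^-1` A).
  exact: (measurable_preimage (@measurable_row_cons _ _)).
have := measurable_fun_ysection leb mcA.
congr (measurable_fun _ _); apply/funext => x /=; congr (leb _).
by apply/seteqP; split => s; rewrite /ysection/= inE.
Qed.

Lemma borel_lebesgue_axis n (A : set 'rV[R]_n.+1) : measurable A ->
  (bl n.+1 A = \int[bl n]_x axis_section A x)%E.
Proof.
move=> mA; have mcA : measurable (@row_cons R n @^-1` A).
  exact: (measurable_preimage (@measurable_row_cons _ _)).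
rewrite [LHS]/(lebesgue_cons _ _) /pushforward.
transitivity ((leb \x^ bl n)%E (@row_cons R n @^-1` A)).
  by apply: product_measure_unique => // *; exact: product_measure2E.
apply: eq_integral => x _ /=; congr (leb _).
by apply/seteqP; split => s; rewrite /ysection/= inE.
Qed.

Lemma lebesgue_centered_interval (c : \bar R) : (0 <= c)%E ->
  leb [set t | ((2 * `|t|)%:E < c)%E] = c.
Proof.
case: c => [r| |]//; last first.
  move=> _; rewrite (_ : [set t | _] = `]-oo, +oo[%classic); last first.
    by rewrite set_itvNyy; apply/seteqP; split => t //= _; rewrite ltry.
  by rewrite lebesgue_measure_itv.
rewrite lee_fin => r0; rewrite (_ : [set t | _] = `](- (r / 2)), (r / 2)[%classic).
  rewrite lebesgue_measure_itv/= lte_fin; case: ltP => h.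
    by rewrite -EFinD; congr EFin; lra.
  by congr EFin; lra.
have E t : (2 * `|t| < r) = (`|t| < r / 2) by rewrite ltr_pdivlMr// mulrC.
by apply/seteqP; split => t /=; rewrite lte_fin in_itv/= -ltr_norml E.
Qed.

Lemma axis_section_steiner n (X : set 'rV[R]_n.+1) x :
  axis_section (steiner_unit (axis n) X) x = axis_section X x.
Proof.
rewrite -[RHS]lebesgue_centered_interval; last first.
  exact: (outer_measure_ge0 ((wlength idfun)^*)%mu).
rewrite [LHS]/axis_section; congr (leb _); apply/seteqP; split => s;
  by [move/steiner_axisE | move=> ?; exact/steiner_axisE].
Qed.

Lemma measurable_steiner_axis n (A : set 'rV[R]_n.+1) : measurable A ->
  measurable (steiner_unit (axis n) A).
Proof.
move=> mA; rewrite (_ : steiner_unit _ _ = @row_uncons n @^-1`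
    [set p | ((2 * `|p.1|)%:E < axis_section A p.2)%E]).
  apply: (measurable_preimage (@measurable_row_uncons n)).
  rewrite -[X in measurable X]setTI; apply: measurable_lte => //.
    apply/measurable_EFinP; apply: measurable_funM => //.
    apply: measurableT_comp => //; exact: measurable_fst.
  exact: (measurableT_comp (measurable_axis_section mA) measurable_snd).
by apply/seteqP; split => x; have := steiner_axisE A (row_uncons x);
  rewrite row_unconsK => -[].
Qed.

(** Symmetrization keeps the length of each section, which [borel_lebesgue_axis]
integrates. *)
Lemma borel_lebesgue_steiner_axis n (A : set 'rV[R]_n.+1) : measurable A ->
  bl n.+1 (steiner_unit (axis n) A) = bl n.+1 A.
Proof.
move=> mA; rewrite !borel_lebesgue_axis//; last exact: measurable_steiner_axis.
by apply: eq_integral => x _; rewrite axis_section_steiner.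
Qed.

Lemma reflection_axis n (e : 'rV[R]_n.+1) : dotv e e = 1 ->
  reflection (axis n - e) (axis n) = e.
Proof. by move=> e1; rewrite reflection_swap// axis_unit. Qed.

Lemma measurable_steiner_unit n (e : 'rV[R]_n.+1) A : dotv e e = 1 ->
  measurable A -> measurable (steiner_unit e A).
Proof.
move=> e1 mA; rewrite -(reflection_axis e1) steiner_unit_reflection.
apply: measurable_preimage; first exact: measurable_reflection.
apply: measurable_steiner_axis.
by apply: measurable_preimage => //; exact: measurable_reflection.
Qed.

Lemma borel_lebesgue_steiner_unit n (e : 'rV[R]_n.+1) A : dotv e e = 1 ->
  measurable A -> bl n.+1 (steiner_unit e A) = bl n.+1 A.
Proof.
move=> e1 mA; rewrite -(reflection_axis e1) steiner_unit_reflection.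
set w := axis n - e; have mwA : measurable (reflection w @^-1` A).
  by apply: measurable_preimage => //; exact: measurable_reflection.
rewrite borel_lebesgue_reflection; last exact: measurable_steiner_axis.
by rewrite borel_lebesgue_steiner_axis// borel_lebesgue_reflection.
Qed.

End steiner_borel.

(** * Steiner symmetrization and rearrangement as contractions *)

Section contractions.
Context {R : realType} {n : nat}.
Implicit Types (X Y Z A B : set 'rV[R]_n.+1) (e w : 'rV[R]_n.+1) (r : R).
Local Notation m := (@lebesgue_rV R n.+1).
Local Notation leb := (@lebesgue_measure R).
Local Open Scope ereal_scope.

Lemma lee_cancel_add (a b p q : \bar R) :
  a \is a fin_num -> b <= a -> a + p = b + q -> p <= q.
Proof. by move=> afin ba E; rewrite -(leeD2lE _ _ afin) E leeD2r. Qed.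

Lemma finite_lebesgueS X Y : lebesgue_measurable X -> X `<=` Y ->
  finite_lebesgue Y -> finite_lebesgue X.
Proof. by move=> mX XY [_ Yoo]; split => //; apply: le_lt_trans Yoo; exact: le_rV. Qed.

Lemma finite_lebesgueI X Y : lebesgue_measurable Y -> finite_lebesgue X ->
  finite_lebesgue (X `&` Y).
Proof.
move=> mY Xf; apply: finite_lebesgueS (Xf); last exact: subIsetl.
exact: (caratheodory_measurable_setI Xf.1 mY).
Qed.

Lemma finite_lebesgue_oball r : finite_lebesgue (oball r : set 'rV[R]_n.+1).
Proof.
have mr := @measurable_oball R n.+1 r.
split; first exact: borel_lebesgue_measurable.
by rewrite lebesgue_rVE// borel_lebesgue_oball_lty.
Qed.

(** A map of sets that is monotone and keeps the measure of Borel sets keeps that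
of all Lebesgue measurable sets of finite measure, since these are squeezed
between Borel sets; and it contracts the distance, since
[T (X `&` Y) `<=` T X `&` T Y]. *)
Section monotone.
Variable T : set 'rV[R]_n.+1 -> set 'rV[R]_n.+1.
Hypothesis T_sub : forall X Y, X `<=` Y -> T X `<=` T Y.
Hypothesis T_borel : forall A, measurable A -> measurable (T A).
Hypothesis T_rV : forall A, measurable A -> m (T A) = m A.

Lemma rV_monotone_le X : m (T X) <= m X.
Proof.
have [H [mH XH <-]] := ex_borel_hull X; rewrite -(T_rV mH).
by apply: le_rV; exact: T_sub.
Qed.

Lemma finite_lebesgue_monotone X : finite_lebesgue X ->
  finite_lebesgue (T X) /\ m (T X) = m X.
Proof.
move=> [mX Xoo]; have [A [B [mA mB AX XB BA0]]] := lebesgue_bracket mX Xoo.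
have AXE : m A = m X.
  apply/eqP; rewrite eq_le (le_rV AX)/=; apply: le_trans (le_rV XB) _.
  rewrite (rV_setD (borel_lebesgue_measurable mA) (subset_trans AX XB)).
  by rewrite [X in _ + X]BA0 adde0.
have BXE : m B = m X.
  rewrite (rV_setD (borel_lebesgue_measurable mA) (subset_trans AX XB)).
  by rewrite [X in _ + X]BA0 adde0.
have TXE : m (T X) = m X.
  by apply/eqP; rewrite eq_le rV_monotone_le/= -AXE -(T_rV mA); apply: le_rV; exact: T_sub.
split=> //; split; last by rewrite TXE.
apply: (@lebesgue_measurable_bracket _ _ (T X) (T A) (T B));
  [exact: T_borel|exact: T_sub|exact: T_sub|].
have Afin : m A \is a fin_num by rewrite rV_fin_num// AXE.
have := rV_setD (borel_lebesgue_measurable (T_borel mA)) (T_sub (subset_trans AX XB)).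
rewrite !T_rV// BXE -AXE -[LHS]adde0 => E; apply: rV_eq0.
exact: (lee_cancel_add Afin (lexx _) (esym E)).
Qed.

Lemma rV_dist_monotone X Y : finite_lebesgue X -> finite_lebesgue Y ->
  rV_dist (T X) (T Y) <= rV_dist X Y.
Proof.
move=> Xf Yf; have [TXf TXE] := finite_lebesgue_monotone Xf.
have [TYf TYE] := finite_lebesgue_monotone Yf.
suff le U V : finite_lebesgue U -> finite_lebesgue V -> m (T U `\` T V) <= m (U `\` V).
  by rewrite (rV_distE _ TXf.1) (rV_distE _ Xf.1); apply: leeD; exact: le.
move=> Uf Vf; have [TUf TUE] := finite_lebesgue_monotone Uf.
have [TVf TVE] := finite_lebesgue_monotone Vf.
have [_ TIE] := finite_lebesgue_monotone (finite_lebesgueI Vf.1 Uf).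
have := rV_setIC (T U) TVf.1; rewrite TUE (rV_setIC U Vf.1) => /esym.
apply: lee_cancel_add; last first.
  by rewrite -TIE; apply: le_rV => x TUVx; split; apply: T_sub TUVx => y [].
rewrite rV_fin_num// (le_lt_trans _ TUf.2)//.
by apply: le_rV; exact: subIsetl.
Qed.

End monotone.

Section steiner_unit.
Variables (e : 'rV[R]_n.+1) (e1 : dotv e e = 1%R).

Let borel A (mA : measurable A) : measurable (steiner_unit e A) :=
  measurable_steiner_unit e1 mA.

Let meas A (mA : measurable A) : m (steiner_unit e A) = m A.
Proof.
by rewrite !lebesgue_rVE// ?borel_lebesgue_steiner_unit//; exact: measurable_steiner_unit.
Qed.

Lemma rV_steiner_le X : m (steiner_unit e X) <= m X.
Proof. exact: (rV_monotone_le (@steiner_unit_sub _ _ e) meas). Qed.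

Lemma finite_lebesgue_steiner X : finite_lebesgue X -> finite_lebesgue (steiner_unit e X).
Proof.
by move=> Xf; have [] := finite_lebesgue_monotone (@steiner_unit_sub _ _ e) borel meas Xf.
Qed.

Lemma rV_steiner X : finite_lebesgue X -> m (steiner_unit e X) = m X.
Proof.
by move=> Xf; have [] := finite_lebesgue_monotone (@steiner_unit_sub _ _ e) borel meas Xf.
Qed.

Lemma rV_dist_steiner X Y : finite_lebesgue X -> finite_lebesgue Y ->
  rV_dist (steiner_unit e X) (steiner_unit e Y) <= rV_dist X Y.
Proof. exact: (rV_dist_monotone (@steiner_unit_sub _ _ e) borel meas). Qed.

(** A line at distance [d] from the origin meets the ball in the centered interval of
half-length [sqrt (r ^ 2 - d ^ 2)]. *)
Lemma steiner_oball r : steiner_unit e (oball r) = oball r.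
Proof.
have [r0|r0] := ltP r 0%R.
  have -> : oball r = set0 :> set 'rV[R]_n.+1.
    apply/seteqP; split => // x; rewrite /oball/= => xr.
    by have := lt_trans xr r0; rewrite ltNge enorm_ge0.
  apply/seteqP; split => // y [x [t [_ _]]] /=.
  rewrite [X in _ < X](outer_measure0 ((wlength idfun)^*)%mu) lte_fin => h.
  by have : (0 <= 2 * `|t|)%R by []; rewrite leNgt h.
have sqrt_lt (a s : R) : (`|s| < Num.sqrt a)%R = (s ^+ 2 < a)%R.
  have [a0|a0] := leP a 0%R.
    rewrite (ler0_sqrtr a0) normr_lt0; apply/esym/negbTE; rewrite -leNgt.
    by apply: le_trans a0 _; exact: sqr_ge0.
  by rewrite -sqrtr_sqr ltr_sqrt.
have len (x : 'rV[R]_n.+1) : dotv x e = 0%R ->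
    leb [set s | oball r (x + s *: e)%R] = (2 * Num.sqrt (r ^+ 2 - dotv x x))%:E.
  move=> xe; rewrite -[RHS]lebesgue_centered_interval; last first.
    by rewrite lee_fin mulr_ge0// sqrtr_ge0.
  congr (leb _); apply/seteqP; split => s;
    rewrite /oball/= lte_fin ltr_pM2l// sqrt_lt ltr_enorm// !dotv_lin
      (dotvC e x) xe e1; lra.
have E (x : 'rV[R]_n.+1) t : dotv x e = 0%R ->
    (2 * `|t|)%:E < (2 * Num.sqrt (r ^+ 2 - dotv x x))%:E = (enorm (x + t *: e) < r)%R.
  move=> xe; rewrite lte_fin ltr_pM2l// sqrt_lt ltr_enorm// !dotv_lin (dotvC e x) xe e1.
  by rewrite ltrBrDl; congr (_ < _)%R; ring.
apply/seteqP; split => y.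
  by move=> [x [t [xe ->]]]; rewrite [X in _ < X](len _ xe) E.
rewrite /oball/= => yr; exists (y - dotv y e *: e)%R, (dotv y e).
have ye : dotv (y - dotv y e *: e) e = 0%R by rewrite !dotv_lin e1 mulr1 subrr.
split => //; first by rewrite subrK.
by rewrite [X in _ < X](len _ ye) E// subrK.
Qed.

End steiner_unit.

Section reflection.
Variable w : 'rV[R]_n.+1.
Local Notation T := (preimage (reflection w)).

Let sub X Y : X `<=` Y -> T X `<=` T Y. Proof. by move=> XY x; exact: XY. Qed.

Let borel A (mA : measurable A) : measurable (T A) :=
  measurable_preimage (measurable_reflection w) mA.

Let meas A (mA : measurable A) : m (T A) = m A.
Proof. by rewrite !lebesgue_rVE// ?borel_lebesgue_reflection//; exact: borel. Qed.

Lemma rV_reflection_le X : m (T X) <= m X.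
Proof. exact: (rV_monotone_le sub meas). Qed.

Lemma finite_lebesgue_reflection X : finite_lebesgue X -> finite_lebesgue (T X).
Proof. by move=> Xf; have [] := finite_lebesgue_monotone sub borel meas Xf. Qed.

Lemma rV_reflection X : finite_lebesgue X -> m (T X) = m X.
Proof. by move=> Xf; have [] := finite_lebesgue_monotone sub borel meas Xf. Qed.

Lemma rV_dist_reflection X Y : finite_lebesgue X -> finite_lebesgue Y ->
  rV_dist (T X) (T Y) <= rV_dist X Y.
Proof. exact: (rV_dist_monotone sub borel meas). Qed.

End reflection.

Lemma rearrangement_oball X : m X < +oo ->
  exists r, [/\ (0 <= r)%R, rearrangement X = oball r & m (oball r) = m X].
Proof.
move=> Xoo; have [r r0 rX] : exists2 r, (0 <= r)%R & m (oball r) = m X.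
  have [|r r0 rX] := @ex_oball R n (m X); first by rewrite rV_ge0 Xoo.
  exists r => //; rewrite lebesgue_rVE//; exact: measurable_oball.
pose P := [set r : R | (0 <= r)%R /\ m (oball r) = m X].
by have [g0 gX] : P (get P) by [apply: getPex; exists r]; exists (get P).
Qed.

Lemma eq_rearrangement X Y : m X = m Y -> rearrangement X = rearrangement Y.
Proof. by rewrite /rearrangement => ->. Qed.

Lemma finite_lebesgue_rearrangement X : m X < +oo -> finite_lebesgue (rearrangement X).
Proof. by move=> /rearrangement_oball[r [_ -> _]]; exact: finite_lebesgue_oball. Qed.

(** Two balls around the origin are nested, so their distance is the difference of
their measures. *)
Lemma rV_dist_rearrangement X Y : m X < +oo -> m Y < +oo ->
  rV_dist (rearrangement X) (rearrangement Y) <= rV_dist X Y.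
Proof.
move=> /[dup] Xoo /rearrangement_oball[r [_ -> rX]].
move=> /[dup] Yoo /rearrangement_oball[s [_ -> sY]].
wlog rs : r s X Y Xoo Yoo rX sY / (r <= s)%R.
  move=> wlg; have [rs|/ltW sr] := leP r s; first exact: (wlg r s).
  by rewrite rV_distC (rV_distC X); exact: (wlg s r).
have sub : oball r `<=` (oball s : set 'rV[R]_n.+1).
  by move=> x /lt_le_trans; exact.
rewrite rV_dist_sub//.
have := rV_setD (finite_lebesgue_oball r).1 sub; rewrite rX sY => E.
rewrite -(leeD2lE _ _ (rV_fin_num Xoo)) -E rV_distC.
exact: le_rV_dist.
Qed.

Lemma steiner_rearrangement e X : dotv e e = 1%R -> m X < +oo ->
  steiner_unit e (rearrangement X) = rearrangement X.
Proof. by move=> e1 /rearrangement_oball[r [_ -> _]]; rewrite steiner_oball. Qed.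

End contractions.

(** * Thickenings *)

Section one_dimensional.
Context {R : realType}.
Local Notation leb := (@lebesgue_measure R).
Local Notation le_leb := (le_outer_measure ((wlength idfun)^*)%mu).

(** The one-dimensional Brunn-Minkowski inequality for an interval: cutting [A]
at one of its points and pushing the two parts away from each other by [s] frees
an interval of length [2 * s]. *)
Lemma lebesgue_thick_le (A D : set (measurableTypeR R)) (a s : R) :
  measurable A -> 0 <= s -> A a ->
  (forall x t, A x -> `|t| <= s -> D (x + t)) ->
  (leb A + (2 * s)%:E <= leb D)%E.
Proof.
move=> mA s0 Aa AD.
pose tr (t : R) (x : measurableTypeR R) : measurableTypeR R := x + t.
have mtr t : measurable_fun setT (tr t) by exact: measurable_funD.
pose A1 : set (measurableTypeR R) := A `&` `]-oo, a[%classic.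
pose A2 : set (measurableTypeR R) := A `&` `]a, +oo[%classic.
have mA1 : measurable A1 by exact: measurableI.
have mA2 : measurable A2 by exact: measurableI.
pose U1 := tr s @^-1` A1; pose U2 := tr (- s) @^-1` A2.
pose I : set (measurableTypeR R) := `[a - s, a + s]%classic.
have mU1 : measurable U1 by exact: (measurable_preimage (mtr _)).
have mU2 : measurable U2 by exact: (measurable_preimage (mtr _)).
have mI : measurable I by exact: measurable_itv.
have UD : U1 `|` U2 `|` I `<=` D.
  move=> x [[[Ax _]|[Ax _]]|].
  - by rewrite -[x](addrK s); apply: AD => //; rewrite normrN ger0_norm.
  - by rewrite -[x](addrNK s); apply: AD => //; rewrite ger0_norm.
  - rewrite /I/= in_itv/= => /andP[x1 x2]; rewrite -[x](subrK a) addrC.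
    by apply: AD => //; rewrite ler_norml; apply/andP; split; lra.
apply: le_trans (le_leb _ _ UD).
have IE : leb I = (2 * s)%:E.
  rewrite /I lebesgue_measure_itv/= lte_fin; case: ltP => h.
    by rewrite -EFinD; congr EFin; lra.
  by congr EFin; lra.
have U12 : U1 `&` U2 = set0.
  apply/seteqP; split => // x [[_ x1] [_ x2]].
  by move: x1 x2; rewrite /tr/= !in_itv/= andbT => ? ?; lra.
have U3 : (U1 `|` U2) `&` I = set0.
  apply/seteqP; split => // x [[[_ x1]|[_ x1]]]; rewrite /I/=;
  by move: x1; rewrite /tr/= !in_itv/= ?andbT => ? /andP[? ?]; lra.
rewrite [leRHS](_ : _ = leb (U1 `|` U2) + leb I)%E; last first.
  exact: (measureU leb (measurableU _ _ mU1 mU2) mI U3).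
rewrite IE leeD2r// [leRHS](_ : _ = leb U1 + leb U2)%E; last first.
  exact: (measureU leb mU1 mU2 U12).
have -> : leb U1 = leb A1 by exact: lebesgue_measure_translate.
have -> : leb U2 = leb A2 by exact: lebesgue_measure_translate.
apply: (@le_trans _ _ (leb (A1 `|` A2 `|` [set a]))).
  apply: le_leb => x Ax; have [xa|xa|->] := ltgtP x a.
  - by left; left; split => //=; rewrite in_itv.
  - by left; right; split => //=; rewrite in_itv/= xa.
  - by right.
apply: le_trans (outer_measureU2 ((wlength idfun)^*)%mu _ _) _.
rewrite [X in (_ + X)%E](lebesgue_measure_set1 a) adde0.
exact: (outer_measureU2 ((wlength idfun)^*)%mu).
Qed.

End one_dimensional.

Section thickening.
Context {R : realType} {n : nat}.
Implicit Types (X Y Z A B J Q : set 'rV[R]_n) (e : R).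
Local Notation m := (@lebesgue_rV R n).

Definition thick (e : R) X : set 'rV[R]_n :=
  [set y | exists2 x, X x & enorm (y - x) < e].

Lemma sub_thick e X : 0 < e -> X `<=` thick e X.
Proof. by move=> e0 x Xx; exists x => //; rewrite subrr enorm0. Qed.

(** A bounded Borel set whose closure exceeds it by a null set, as the
thickenings decrease to the closure. *)
Definition good X := [/\ measurable X, exists r, X `<=` oball r &
  forall e, 0 < e -> exists2 h, 0 < h & (m (thick h X) <= m X + e%:E)%E].

Lemma good_finite X : good X -> finite_lebesgue X.
Proof.
move=> [mX [r Xr] _]; split; first exact: borel_lebesgue_measurable.
apply: le_lt_trans (le_rV Xr) _; rewrite lebesgue_rVE; last exact: measurable_oball.
exact: borel_lebesgue_oball_lty.
Qed.

End thickening.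

(** The section of [thick h X] by a line contains the [sqrt (h ^ 2 - d ^ 2)]-
neighbourhood of the section of [X] by any parallel line at distance [d < h], and
[lebesgue_thick_le] compares their lengths. Hence the measure of a thickening
decreases along any sequence of symmetrizations, as the perimeter does. *)
Lemma thick_steiner_sub (R : realType) n (e : 'rV[R]_n) h (X : set 'rV[R]_n) :
  dotv e e = 1 -> measurable X ->
  thick h (steiner_unit e X) `<=` steiner_unit e (thick h X).
Proof.
move=> e1 mX y [_ [x [t [xe -> tX]]]]; set v := y - _ => vh.
have h0 : 0 <= h by exact: le_trans (enorm_ge0 v) (ltW vh).
(* The displacement [v] is split along [e] and across it. *)
pose tau := dotv v e; pose v' := v - tau *: e.
have v'e : dotv v' e = 0 by rewrite /v' dotvDl dotvNl dotvZl e1 mulr1 subrr.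
have vE : v = v' + tau *: e by rewrite subrK.
clearbody v'.
exists (x + v'), (t + tau); split.
- by rewrite dotvDl xe v'e addr0.
- by rewrite -[y](subrK (x + t *: e)) -/v vE; apply/rowP => i; rewrite !mxE; ring.
pose A : set (measurableTypeR R) := [set s | X (x + s *: e)].
have mA : measurable A.
  apply: (@measurable_preimage _ _ (measurableTypeR R) _ (fun s => x + s *: e)) mX.
  by apply: measurable_funD_row => //; exact: measurable_funZ_row.
have [a Aa] : A !=set0.
  apply/set0P/eqP => A0; move: tX; rewrite -/A A0.
  rewrite [X in (_ < X)%E](outer_measure0 ((wlength idfun)^*)%mu) lte_fin.
  by apply/negP; rewrite -leNgt.
apply: lt_le_trans (lebesgue_thick_le mA (normr_ge0 tau) Aa _).
  rewrite (@le_lt_trans _ _ ((2 * `|t|)%:E + (2 * `|tau|)%:E)%E)//.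
    by rewrite -EFinD lee_fin -mulrDr ler_pM2l// ler_normD.
  by rewrite lteD2rE.
move=> s r As rtau; exists (x + s *: e) => //.
rewrite (_ : _ - _ = v' + r *: e); last by apply/rowP => i; rewrite !mxE; ring.
move: vh; rewrite !ltr_enorm// vE !dotv_lin e1 (dotvC e) v'e.
have : r ^+ 2 <= tau ^+ 2.
  by rewrite -(real_normK (num_real r)) -(real_normK (num_real tau)) ler_pXn2r ?nnegrE.
by rewrite !expr2; lra.
Qed.

(** * Density of the good sets *)

Section density.
Context {R : realType} {n : nat}.
Implicit Types (X Y Z A B J Q : set 'rV[R]_n) (e : R).
Local Notation m := (@lebesgue_rV R n).
Local Notation leb := (@lebesgue_measure R).

Lemma rV_small_tail (F : nat -> set 'rV[R]_n) e : (m (F 0%N) < +oo)%E ->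
  (forall k, measurable (F k)) -> (forall i j, (i <= j)%N -> F j `<=` F i) ->
  \bigcap_k F k = set0 -> 0 < e -> exists k, (m (F k) <= e%:E)%E.
Proof.
move=> F0 mF ndF F_0 e0; apply: contrapT => /forallNP Fe.
have bF : (borel_lebesgue n (F 0%N) < +oo)%E by rewrite -lebesgue_rVE.
have mcF : measurable (\bigcap_k F k) by exact: bigcapT_measurable.
have := nonincreasing_cvg_mu bF mF mcF _; rewrite F_0 measure0 => cF.
have {}cF := cF (fun i j ij => introT (subsetPset _ _) (ndF i j ij)).
have : (e%:E <= 0)%E.
  apply: (cvge_to_ge cF); apply: nearW => k /=.
  by rewrite -lebesgue_rVE// ltW// ltNge; apply/negP; exact: Fe.
by rewrite lee_fin leNgt e0.
Qed.

(** Sets whose boundary is null inside [Q]. Unlike [good], the condition is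
symmetric in [J] and its complement, so that these sets form an algebra. *)
Definition jordan Q J := measurable J /\ forall e, 0 < e ->
  exists2 h, 0 < h & (m (Q `&` (thick h J `&` thick h (~` J))) <= e%:E)%E.

Lemma jordanC Q J : jordan Q J -> jordan Q (~` J).
Proof.
move=> [mJ JQ]; split; first exact: measurableC.
by move=> e /JQ[h h0 he]; exists h => //; rewrite setCK [_ `&` thick h J]setIC.
Qed.

Lemma jordanU Q J K : jordan Q J -> jordan Q K -> jordan Q (J `|` K).
Proof.
move=> [mJ JQ] [mK KQ]; split; first exact: measurableU.
move=> e e0; have e20 : 0 < e / 2 by rewrite divr_gt0.
have [h h0 hJ] := JQ _ e20; have [k k0 kK] := KQ _ e20.
exists (Num.min h k); first by rewrite lt_min h0 k0.
rewrite [e]splitr EFinD; apply: le_trans (leeD hJ kK).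
apply: le_trans (rV_setU _ _); apply: le_rV => x [Qx [[y JKy xy] [z zJK xz]]].
move: JKy => [Jy|Ky]; [left|right]; split => //; split.
- by exists y => //; rewrite (lt_le_trans xy)// ge_min lexx.
- exists z; first by move=> Jz; apply: zJK; left.
  by rewrite (lt_le_trans xz)// ge_min lexx.
- by exists y => //; rewrite (lt_le_trans xy)// ge_min lexx orbT.
- exists z; first by move=> Kz; apply: zJK; right.
  by rewrite (lt_le_trans xz)// ge_min lexx orbT.
Qed.

Lemma jordanI Q J K : jordan Q J -> jordan Q K -> jordan Q (J `&` K).
Proof.
move=> JQ KQ; rewrite -[_ `&` _]setCK setCI.
by apply: jordanC; apply: jordanU; exact: jordanC.
Qed.

Lemma jordan0 Q : jordan Q set0.
Proof.
split => // e e0; exists 1 => //.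
by rewrite (_ : thick 1 set0 = set0) ?set0I ?setI0 ?rV_set0 ?lee_fin ?ltW//;
  apply/seteqP; split => // x [].
Qed.

Lemma jordanT Q : jordan Q setT.
Proof. by rewrite -setC0; apply: jordanC; exact: jordan0. Qed.

(** The boundary of a halfspace meets a cube in a slab of small width. *)
Lemma jordan_slab (L a : R) i J : measurable J ->
  (forall h x, 0 < h -> thick h J x -> thick h (~` J) x -> `|x ord0 i - a| < h) ->
  jordan (cube L) J.
Proof.
move=> mJ Ja; split => // e e0.
pose c := \prod_(j < n | j != i) (`|L| *+ 2).
have c0 : 0 <= c by apply: prodr_ge0 => j _; rewrite mulrn_wge0.
have c1 : 0 < c + 1 by rewrite ltr_wpDl.
(* [c] is the measure of the cross-section of the slab; [c + 1] avoids dividing by [0]. *)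
pose h := e / 2 / (c + 1); have h0 : 0 < h by rewrite !divr_gt0.
exists h => //.
pose S (j : 'I_n) : set R := if j == i then `]a - h, a + h[%classic
  else `]- `|L|, `|L|[%classic.
have mS j : measurable (S j) by rewrite /S; case: ifP.
have SE : (m [set x | forall j, S j (x ord0 j)] = (h *+ 2 * c)%:E)%E.
  rewrite lebesgue_rVE; last exact: measurable_box.
  rewrite borel_lebesgue_box// (bigD1 i)//= /c EFinM -prodEFin; congr (_ * _)%E.
    rewrite /S eqxx lebesgue_measure_itv/= lte_fin; case: ltP => ah.
      by rewrite -EFinD; congr EFin; lra.
    by congr EFin; lra.
  apply: eq_bigr => j ji; rewrite /S (negbTE ji) lebesgue_measure_itv/= lte_fin.
  case: ltP => LL; first by rewrite -EFinD; congr EFin; lra.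
  by congr EFin; move: (normr_ge0 L); lra.
apply: (@le_trans _ _ (m [set x | forall j, S j (x ord0 j)])).
  apply: le_rV => x [xL [Jx Jx']] j; rewrite /S; case: eqP => [->|_].
    have := Ja _ _ h0 Jx Jx'; rewrite /= in_itv/= ltr_norml.
    by move=> /andP[? ?]; apply/andP; split; lra.
  by rewrite /= in_itv/= -ltr_norml (lt_le_trans (xL j))// ler_norm.
rewrite SE lee_fin /h -mulr_natr.
rewrite (_ : e / 2 / (c + 1) * 2%:R * c = e * (c / (c + 1))); last first.
  by field; rewrite gt_eqF.
by rewrite ger_pMr// ler_pdivrMr// mul1r lerDl.
Qed.

Lemma measurable_coord_preimage i (B : set R) : measurable B ->
  measurable [set x : 'rV[R]_n | B (x ord0 i)].
Proof. exact: (measurable_preimage (measurable_coord i)). Qed.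

Lemma jordan_gt (L a : R) i : jordan (cube L) [set x | a < x ord0 i].
Proof.
apply: (@jordan_slab _ a i).
  have := @measurable_coord_preimage i `]a, +oo[%classic (measurable_itv _).
  by congr measurable; apply/seteqP; split => x; rewrite /= in_itv/= andbT.
move=> h x h0 [y /= ay xy] [z /= az xz].
have xy' := le_lt_trans (coord_le_enorm _ i) xy.
have xz' := le_lt_trans (coord_le_enorm _ i) xz.
move: xy' xz' az; rewrite !mxE !ltr_norml => /andP[? ?] /andP[? ?] /negP.
by rewrite -leNgt => ?; apply/andP; split; lra.
Qed.

Lemma jordan_lt (L a : R) i : jordan (cube L) [set x | x ord0 i < a].
Proof.
apply: (@jordan_slab _ a i).
  have := @measurable_coord_preimage i `]-oo, a[%classic (measurable_itv _).
  by congr measurable; apply/seteqP; split => x; rewrite /= in_itv.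
move=> h x h0 [y /= ay xy] [z /= az xz].
have xy' := le_lt_trans (coord_le_enorm _ i) xy.
have xz' := le_lt_trans (coord_le_enorm _ i) xz.
move: xy' xz' az; rewrite !mxE !ltr_norml => /andP[? ?] /andP[? ?] /negP.
by rewrite -leNgt => ?; apply/andP; split; lra.
Qed.

Lemma jordan_cube (L c : R) : jordan (cube L) (cube c).
Proof.
rewrite (_ : cube c = \big[setI/setT]_(i <- index_enum 'I_n)
  ([set x : 'rV[R]_n | - c < x ord0 i] `&` [set x | x ord0 i < c])).
  elim/big_ind : _ => [| |i _]; first exact: jordanT.
    by move=> J K; exact: jordanI.
  by apply: jordanI; [exact: jordan_gt|exact: jordan_lt].
rewrite -bigcap_seq; apply/seteqP; split => x xc i.
  by move=> _; have := xc i; rewrite ltr_norml => /andP.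
by have := xc i (mem_index_enum i); rewrite ltr_norml => -[/= -> ->].
Qed.

Definition jordan_approx Q A := measurable A /\ forall e, 0 < e ->
  exists2 J, jordan Q J & (m (Q `&` (A `+` J)) <= e%:E)%E.

Lemma jordan_approx_jordan Q J : jordan Q J -> jordan_approx Q J.
Proof.
move=> jJ; split; first by case: jJ.
by move=> e e0; exists J => //; rewrite setYK setI0 rV_set0 lee_fin ltW.
Qed.

Lemma jordan_approxU Q A B :
  jordan_approx Q A -> jordan_approx Q B -> jordan_approx Q (A `|` B).
Proof.
move=> [mA AQ] [mB BQ]; split; first exact: measurableU.
move=> e e0; have e20 : 0 < e / 2 by rewrite divr_gt0.
have [J jJ AJ] := AQ _ e20; have [K jK BK] := BQ _ e20.
exists (J `|` K); first exact: jordanU.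
rewrite [e]splitr EFinD; apply: le_trans (leeD AJ BK).
apply: le_trans (rV_setU _ _); apply: le_rV => x [Qx [[AB /not_orP[Jx Kx]]|]].
  by case: AB => [?|?]; [left|right]; split => //; left.
by move=> [[?|?] /not_orP[? ?]]; [left|right]; split => //; right.
Qed.

Lemma jordan_approxC Q A : jordan_approx Q A -> jordan_approx Q (~` A).
Proof.
move=> [mA AQ]; split; first exact: measurableC.
move=> e /AQ[J jJ AJ]; exists (~` J); first exact: jordanC.
apply: le_trans AJ; apply: le_rV => x [Qx [[Ax /contrapT Jx]|[Jx /contrapT Ax]]].
  by split => //; right.
by split => //; left.
Qed.

(** A countable union differs from a finite one by a set of small measure inside [Q],
and Jordan sets are closed under complements and finite unions. *)
Lemma jordan_approx_sigma_algebra Q : measurable Q -> (m Q < +oo)%E ->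
  sigma_algebra setT (jordan_approx Q).
Proof.
move=> mQ Qoo; split.
- exact/jordan_approx_jordan/jordan0.
- by move=> A; rewrite setTD; exact: jordan_approxC.
move=> F jF; have mF k : measurable (F k) by case: (jF k).
split; first exact: bigcupT_measurable.
move=> e e0; have e20 : 0 < e / 2 by rewrite divr_gt0.
pose U k := \big[setU/set0]_(i < k) F i.
have jU k : jordan_approx Q (U k).
  rewrite /U; elim/big_ind : _ => //.
    exact/jordan_approx_jordan/jordan0.
  by move=> A B; exact: jordan_approxU.
pose T k := Q `&` (\bigcup_i F i `\` U k).
have [||||k Tk] := @rV_small_tail T (e / 2) _ _ _ _ e20.
- by apply: le_lt_trans Qoo; apply: le_rV => x [].
- move=> k; apply: measurableI => //; apply: measurableD.
    exact: bigcupT_measurable.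
  by case: (jU k).
- move=> i j ij x [Qx [Fx Ux]]; split => //; split => //; apply: contra_not Ux.
  by move=> Ux; apply: subset_bigsetU Ux.
- apply/seteqP; split => // x Tx; have [_ [[i _ Fi] _]] := Tx 0%N I.
  have [_ [_]] := Tx i.+1 I; apply.
  by rewrite /U big_ord_recr/=; right.
have [J jJ UJ] := (jU k).2 _ e20; exists J => //.
rewrite [e]splitr EFinD; apply: le_trans (leeD Tk UJ).
apply: le_trans (rV_setU _ _); apply: le_rV => x [Qx].
have [Ux|Ux] := pselect (U k x) => -[[Fx Jx]|[Jx Fx]].
- by right; split => //; left.
- exfalso; apply: Fx; move: Ux; rewrite /U -bigcup_mkord => -[i _ Fi].
  by exists i.
- by left; split.
- by right; split => //; right.
Qed.

(** Coordinate halfspaces are Jordan sets and generate the Borel sets. *)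
Lemma jordan_approx_measurable (L : R) A : measurable A ->
  jordan_approx (cube L) A.
Proof.
have Lfin : (m (cube L) < +oo)%E.
  apply: (@le_lt_trans _ _ (m (cube `|L|))).
    by apply: le_rV => x xL i; rewrite (lt_le_trans (xL i))// ler_norm.
  by rewrite lebesgue_rVE ?borel_lebesgue_cube ?ltry//; exact: measurable_cube.
have sQ := jordan_approx_sigma_algebra (@measurable_cube _ _ L) Lfin.
suff sub : g_sigma_preimage (fun (i : 'I_n) (x : 'rV[R]_n) => x ord0 i) `<=`
    jordan_approx (cube L) by exact: sub.
apply: smallest_sub => // B; rewrite -bigcup_seq/= => -[i _ [C mC <-]].
rewrite setTI; move: mC.
suff : <<s @RGenOInfty.G R >> `<=`
    [set C | jordan_approx (cube L) ((fun x : 'rV[R]_n => x ord0 i) @^-1` C)].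
  by rewrite -[<<s _ >>]RGenOInfty.measurableE; exact.
have [s0 sC sU] := sQ; apply: smallest_sub.
  split => [|D DQ|F FQ] /=; first by rewrite preimage_set0.
  - by rewrite setTD preimage_setC -setTD; exact: sC.
  - by rewrite preimage_bigcup; exact: sU.
move=> _ [a ->]; have := jordan_approx_jordan (@jordan_gt L a i).
by congr jordan_approx; apply/seteqP; split => x; rewrite /= in_itv/= andbT.
Qed.

Lemma good_jordan (c : R) J : jordan (cube (c + 1)) J -> J `<=` cube c -> good J.
Proof.
move=> [mJ Jh] Jc; split => //.
  exists (n%:R * `|c| + 1) => x /Jc xc; rewrite /oball/= ltr_pwDr//.
  by apply: enorm_le_coord => // i; rewrite (le_trans (ltW (xc i)))// ler_norm.
move=> e e0; have [h h0 he] := Jh _ e0.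
exists (Num.min h 1); first by rewrite lt_min h0 ltr01.
have h1 : 0 < Num.min h 1 by rewrite lt_min h0 ltr01.
rewrite (rV_setD (borel_lebesgue_measurable mJ) (sub_thick (X:=J) h1)) leeD2l//.
apply: le_trans he; apply: le_rV => x [[y Jy xy] Jx]; split; last first.
  split; first by exists y => //; rewrite (lt_le_trans xy)// ge_min lexx.
  by exists x => //; rewrite subrr enorm0.
move=> i; rewrite -[x](subrK y) mxE addrC (le_lt_trans (ler_normD _ _))//.
rewrite ltrD ?Jc//; apply: le_lt_trans (coord_le_enorm _ i) _.
by rewrite (lt_le_trans xy)// ge_min lexx orbT.
Qed.

(** After truncation by a cube, [X] is approximated by a Jordan set, which is then
cut by the same cube. The approximation takes place in a larger cube, where the
boundary of the cut is seen to be null. *)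
Lemma good_dense X e : finite_lebesgue X -> 0 < e ->
  exists2 C, good C & (rV_dist X C <= e%:E)%E.
Proof.
move=> [mX Xoo] e0; have e20 : 0 < e / 2 by rewrite divr_gt0.
have [A [B [mA mB AX XB BA0]]] := lebesgue_bracket mX Xoo.
have XA0 : rV_dist X A = 0%E.
  rewrite rV_distC rV_dist_sub//; apply: rV_eq0; rewrite -BA0; apply: le_rV.
  by move=> x [Xx Ax]; split => //; exact: XB.
have [||||k Tk] := @rV_small_tail (fun k => A `\` cube k%:R) (e / 2) _ _ _ _ e20.
- by apply: le_lt_trans Xoo; apply: le_rV => x [/AX].
- by move=> k; apply: measurableD => //; exact: measurable_cube.
- move=> i j ij x [Ax xj]; split => //; apply: contra_not xj => xi k.
  by rewrite (lt_le_trans (xi k))// ler_nat.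
- apply/seteqP; split => // x Ax; have [_] := Ax (Num.bound (enorm x)) I; apply => i.
  apply: le_lt_trans (coord_le_enorm x i) _.
  by rewrite archi_boundP// enorm_ge0.
have [_ /(_ _ e20)[J jJ AJ]] := jordan_approx_measurable (k%:R + 1) mA.
exists (J `&` cube k%:R).
  apply: (@good_jordan k%:R); last exact: subIsetr.
  by apply: jordanI => //; exact: jordan_cube.
apply: le_trans (rV_dist_triangle A _ _) _; rewrite XA0 add0e [e]splitr EFinD.
apply: le_trans (leeD Tk AJ); apply: le_trans (rV_setU _ _); apply: le_rV => x.
have sub : cube k%:R x -> cube (k%:R + 1) x.
  by move=> xk i; rewrite (lt_le_trans (xk i))// lerDl.
have [xk|xk] := pselect (cube k%:R x) => -[[Ax Jx]|[[Jx ?] Ax]]//.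
- by right; split; [exact: sub|left; split => // Jx'; exact: Jx].
- by right; split; [exact: sub|right].
- by left.
Qed.

End density.

(** * Continuity of the symmetrization in its direction *)

Section continuity.
Context {R : realType} {n : nat}.
Implicit Types (X Y C : set 'rV[R]_n.+1) (u v w x : 'rV[R]_n.+1).
Local Notation m := (@lebesgue_rV R n.+1).

Lemma enorm_unit u : dotv u u = 1 -> enorm u = 1.
Proof. by rewrite /enorm => ->; rewrite sqrtr1. Qed.

(** The normal [u + v] has squared length [4 - |v - u| ^ 2], hence stays away from [0]
and the reflection depends on it in a Lipschitz way. *)
Lemma reflection_near u v x : dotv u u = 1 -> dotv v v = 1 -> enorm (v - u) <= 1 ->
  enorm (reflection (u + v) x - reflection (u + u) x) <= 4 * enorm x * enorm (v - u).
Proof.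
move=> u1 v1; have : v = u + (v - u) by rewrite addrC subrK.
move: (v - u) => h vE; set d := enorm h => d1.
have d0 : 0 <= d by exact: enorm_ge0.
have hh : dotv h h = d ^+ 2 by rewrite sqr_enorm.
have uh : 2 * dotv u h = - d ^+ 2.
  by move: v1; rewrite vE !dotv_lin u1 hh (dotvC h u); lra.
set a := dotv x u; set b := dotv x h.
have ax : `|a| <= enorm x.
  by rewrite (le_trans (le_dotv_enorm _ _))// (enorm_unit u1) mulr1.
have bx : `|b| <= enorm x * d by exact: le_dotv_enorm.
have x0 := enorm_ge0 x.
pose s := 4 - d ^+ 2; have s3 : 3 <= s by rewrite /s; nra.
have s0 : s != 0 by rewrite gt_eqF//; lra.
have ss : dotv (u + v) (u + v) = s.
  by rewrite vE !dotv_lin u1 hh (dotvC h u) /s; lra.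
(* Coefficients of [u] and [h] once the difference is put over the denominator [s]. *)
pose p := - 2 * d ^+ 2 * a - 4 * b; pose q := 4 * a + 2 * b.
have E : reflection (u + v) x - reflection (u + u) x = s^-1 *: (p *: u - q *: h).
  rewrite /reflection ss vE !dotv_lin u1 -/a -/b.
  by apply/rowP => i; rewrite !mxE /p /q /s; field; rewrite -/s s0.
rewrite E enormZ gtr0_norm ?invr_gt0 ?(lt_le_trans _ s3)// mulrC ler_pdivrMr; last lra.
apply: (@le_trans _ _ (`|p| + `|q| * d)).
  apply: le_trans (enormD _ _) _; rewrite enormN !enormZ (enorm_unit u1) mulr1.
  by rewrite lerD2l.
have pb : `|p| <= 2 * d ^+ 2 * enorm x + 4 * (enorm x * d).
  rewrite (le_trans (ler_normB _ _))// lerD// normrM.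
    rewrite normrM normrN (ger0_norm (ler0n _ 2)) (ger0_norm (sqr_ge0 d)).
    by rewrite ler_wpM2l// mulr_ge0// sqr_ge0.
  by rewrite (ger0_norm (ler0n _ 4)) ler_wpM2l.
have qb : `|q| <= 4 * enorm x + 2 * (enorm x * d).
  rewrite (le_trans (ler_normD _ _))// lerD// normrM.
    by rewrite (ger0_norm (ler0n _ 4)) ler_wpM2l.
  by rewrite (ger0_norm (ler0n _ 2)) ler_wpM2l.
have qd : `|q| * d <= (4 * enorm x + 2 * (enorm x * d)) * d by rewrite ler_wpM2r.
have xd0 : 0 <= enorm x * d by rewrite mulr_ge0.
have dd : enorm x * d * d <= enorm x * d by rewrite ler_piMr.
have ds : 3 * (4 * (enorm x * d)) <= s * (4 * (enorm x * d)).
  by rewrite ler_wpM2r// mulr_ge0.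
by move: pb qd dd ds; rewrite !expr2; lra.
Qed.

(** For a good set the reflected images are eventually contained in thickenings
of each other; the general case follows by density. *)
Lemma reflection_continuous u X (e : R) : dotv u u = 1 -> finite_lebesgue X -> 0 < e ->
  exists2 d, 0 < d & forall v, dotv v v = 1 -> enorm (v - u) < d ->
    (rV_dist (reflection (u + v) @^-1` X) (reflection (u + u) @^-1` X) <= e%:E)%E.
Proof.
move=> u1 Xf e0; have e40 : 0 < e / 4 by rewrite divr_gt0.
have [C gC XC] := good_dense Xf e40; have Cf := good_finite gC.
have [mC [r Cr] /(_ _ e40)[h h0 hC]] := gC.
pose r' := 4 * (`|r| + 1); have r'0 : 0 < r' by rewrite mulr_gt0// ltr_wpDl.
exists (Num.min 1 (h / r')); first by rewrite lt_min ltr01 divr_gt0.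
move=> v v1; rewrite lt_min => /andP[d1 dh].
have CT : (m (thick h C `\` C) <= (e / 4)%:E)%E.
  rewrite -(leeD2lE _ _ (rV_fin_num Cf.2)) -(rV_setD Cf.1)//.
  exact: sub_thick.
have near w w' :
    (forall x, enorm (reflection w x - reflection w' x) <= 4 * enorm x * enorm (v - u)) ->
    (m (reflection w @^-1` C `\` reflection w' @^-1` C) <= (e / 4)%:E)%E.
  move=> ww'; apply: le_trans CT; apply: le_trans (rV_reflection_le w' _).
  apply: le_rV => x [Cx C'x]; split => //; exists (reflection w x) => //.
  rewrite enormB (le_lt_trans (ww' x))//.
  have xr : enorm x < `|r| + 1.
    rewrite -(enorm_reflection w) (lt_le_trans (Cr _ Cx))//.
    by rewrite (le_trans (ler_norm r))// lerDl.
  rewrite (@le_lt_trans _ _ (r' * enorm (v - u)))//.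
    by rewrite ler_wpM2r ?enorm_ge0// /r' ler_pM2l// ltW.
  by rewrite mulrC -ltr_pdivlMr.
have {near}CC : (rV_dist (reflection (u + v) @^-1` C) (reflection (u + u) @^-1` C)
    <= (e / 4 + e / 4)%:E)%E.
  rewrite rV_distE; last by have [] := finite_lebesgue_reflection (u + v) Cf.
  rewrite EFinD; apply: leeD; apply: near => x.
    exact: reflection_near (ltW d1).
  by rewrite enormB; exact: reflection_near (ltW d1).
apply: le_trans (rV_dist_triangle (reflection (u + v) @^-1` C) _ _) _.
apply: (@le_trans _ _ ((e / 4)%:E + ((e / 4 + e / 4)%:E + (e / 4)%:E))%E).
  apply: leeD; first by apply: le_trans (rV_dist_reflection _ Xf Cf) _.
  apply: le_trans (rV_dist_triangle (reflection (u + u) @^-1` C) _ _) _.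
  apply: leeD => //; apply: le_trans (rV_dist_reflection _ Cf Xf) _.
  by rewrite rV_distC.
by rewrite -!EFinD lee_fin; lra.
Qed.

(** The reflection exchanging [u] and [- v] conjugates the symmetrization along
[u] to that along [v]. *)
Lemma steiner_conjugate u v X : dotv u u = 1 -> dotv v v = 1 ->
  steiner_unit v X =
  reflection (u + v) @^-1` steiner_unit u (reflection (u + v) @^-1` X).
Proof.
move=> u1 v1; rewrite -steiner_unit_reflection -[v in u + v]opprK.
by rewrite reflection_swap ?steiner_unitN// !dotv_lin opprK v1.
Qed.

Lemma steiner_continuous u X (e : R) : dotv u u = 1 -> finite_lebesgue X -> 0 < e ->
  exists2 d, 0 < d & forall v, dotv v v = 1 -> enorm (v - u) < d ->
    (rV_dist (steiner_unit v X) (steiner_unit u X) <= e%:E)%E.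
Proof.
move=> u1 Xf e0; have e20 : 0 < e / 2 by rewrite divr_gt0.
pose Y := steiner_unit u (reflection (u + u) @^-1` X).
have Yf : finite_lebesgue Y.
  exact/(finite_lebesgue_steiner u1)/finite_lebesgue_reflection.
have [d d0 dX] := reflection_continuous u1 Xf e20.
have [d' d'0 dY] := reflection_continuous u1 Yf e20.
exists (Num.min d d'); first by rewrite lt_min d0.
move=> v v1; rewrite lt_min => /andP[vd vd'].
rewrite (steiner_conjugate X u1 v1) (steiner_conjugate X u1 u1).
have Xv := finite_lebesgue_reflection (u + v) Xf.
have Xu := finite_lebesgue_reflection (u + u) Xf.
apply: le_trans (rV_dist_triangle (reflection (u + v) @^-1` Y) _ _) _.
rewrite [e]splitr EFinD; apply: leeD; last exact: dY.
apply: le_trans (rV_dist_reflection _ _ Yf) _; first exact: finite_lebesgue_steiner.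
by apply: le_trans (rV_dist_steiner u1 Xv Xu) _; exact: dX.
Qed.

End continuity.

(** * Total boundedness *)

Section grid.
Context {R : realType} {n : nat}.
Implicit Types (Y Z : set 'rV[R]_n) (L h e : R).

(** The indices count from the corner with all coordinates equal to [- L]. *)
Definition grid_cell L h M (t : {ffun 'I_n -> 'I_M}) : set 'rV[R]_n :=
  [set x | forall i, (t i)%:R * h <= x ord0 i + L < (t i).+1%:R * h].

Lemma measurable_grid_cell L h M (t : {ffun 'I_n -> 'I_M}) :
  measurable (grid_cell L h t).
Proof.
rewrite (_ : grid_cell L h t = [set x | forall i,
    `[(t i)%:R * h - L, (t i).+1%:R * h - L[%classic (x ord0 i)]).
  exact: (measurable_box (fun i => measurable_itv _)).
by apply/seteqP; split => x xt i; have := xt i;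
  rewrite /= in_itv/= lerBlDr ltrBrDr.
Qed.

(** The cover is by unions of the finitely many cells of a fine grid; for [Y] one takes
the cells that [Y] meets, whose diameter is less than [e]. *)
Lemma finite_grid_cover L e : 0 < e ->
  exists (I : finType) (Z : I -> set 'rV[R]_n), (forall i, measurable (Z i)) /\
    forall Y, Y `<=` cube L -> exists i, Y `<=` Z i /\ Z i `<=` thick e Y.
Proof.
move=> e0; pose h := e / n.+1%:R; have h0 : 0 < h by rewrite divr_gt0.
pose M := Num.bound (2 * `|L| / h).
pose K := {ffun 'I_n -> 'I_M}.
exists {set K}.
exists (fun T : {set K} => \bigcup_(t in [set t : K | t \in T]) grid_cell `|L| h t).
split=> [T|Y YL].
  by apply: fin_bigcup_measurable => // t _; exact: measurable_grid_cell.
exists [set t : K | `[< exists2 y, Y y & grid_cell `|L| h t y >]]%SET; split => [y Yy|].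
  have key i : exists k : 'I_M, k%:R * h <= y ord0 i + `|L| < k.+1%:R * h.
    have : `|y ord0 i| < `|L| by rewrite (lt_le_trans (YL _ Yy i))// ler_norm.
    rewrite ltr_norml => /andP[y1 y2].
    have y0 : 0 <= (y ord0 i + `|L|) / h by rewrite divr_ge0 ?ltW//; lra.
    have /andP[k1 k2] := truncn_itv y0.
    have kM : (Num.truncn ((y ord0 i + `|L|) / h) < M)%N.
      rewrite -(ltr_nat R) (le_lt_trans k1)// (lt_trans _ (archi_boundP _))//.
        by rewrite ltr_pM2r ?invr_gt0//; lra.
      by rewrite !mulr_ge0// invr_ge0 ltW.
    by exists (Ordinal kM) => /=; rewrite -ler_pdivlMr// k1 -ltr_pdivrMr.
  have [f fP] := choice key.
  have cy : grid_cell `|L| h [ffun i => f i] y by move=> i; rewrite ffunE.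
  by exists [ffun i => f i] => //=; rewrite inE; apply/asboolP; exists y.
move=> x [t /=]; rewrite inE => /asboolP[y Yy ty] tx; exists y => //.
apply: (@le_lt_trans _ _ (n%:R * h)).
  apply: enorm_le_coord => [|i]; first exact: ltW.
  have := tx i; have := ty i; rewrite !mxE -natr1 mulrDl mul1r.
  by move=> /andP[? ?] /andP[? ?]; rewrite ler_norml; apply/andP; split; lra.
rewrite /h mulrCA gtr_pMr// ltr_pdivrMr ?mul1r ?ltr_nat//.
Qed.

End grid.

(** * A functional that symmetrization strictly increases *)

Section energy.
Context {R : realType} {n : nat}.
Implicit Types (X Y A B : set 'rV[R]_n.+1) (e : 'rV[R]_n.+1).
Local Notation m := (@lebesgue_rV R n.+1).
Local Notation leb := (@lebesgue_measure R).

Definition radius (k : nat) : R := oapp ratr 0 (choice.unpickle k : option rat).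

Lemma ex_radius (a b : R) : a < b -> exists k, a < radius k < b.
Proof.
move=> /rat_in_itvoo[q]; rewrite in_itv/= => qab.
by exists (choice.pickle q); rewrite /radius choice.pickleK.
Qed.

Let ball k : set 'rV[R]_n.+1 := oball (radius k).

(** The integral over [X] of a radially decreasing weight, spread over countably
many balls so that monotonicity is read off ball by ball. *)
Definition energy X : \bar R :=
  (\sum_(0 <= k <oo) ((2 ^ k.+1)%:R^-1)%:E * m (X `&` ball k))%E.

Let c k : R := (2 ^ k.+1)%:R^-1.

Let c_gt0 k : 0 < c k.
Proof. by rewrite invr_gt0 ltr0n expn_gt0. Qed.

Let term_ge0 X k : (0 <= (c k)%:E * m (X `&` ball k))%E.
Proof. by rewrite mule_ge0 ?rV_ge0// lee_fin ltW. Qed.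

Let ball_fin X k : m (X `&` ball k) \is a fin_num.
Proof.
rewrite rV_fin_num// (le_lt_trans _ (@finite_lebesgue_oball R n (radius k)).2)//.
by apply: le_rV; exact: subIsetr.
Qed.

Lemma energy_ge0 X : (0 <= energy X)%E.
Proof. by apply: nneseries_ge0 => k _ _; exact: term_ge0. Qed.

Lemma energy_dist X Y : (energy X <= energy Y + rV_dist X Y)%E.
Proof.
have [->|dfin] := eqVneq (rV_dist X Y) +oo%E.
  by rewrite addey ?leey// gt_eqF// (lt_le_trans _ (energy_ge0 Y)).
have {}dfin : rV_dist X Y \is a fin_num by rewrite rV_fin_num// ltey.
have d0 : 0 <= fine (rV_dist X Y) by rewrite fine_ge0// rV_ge0.
rewrite -(fineK dfin); apply: le_trans (epsilon_trick _ (term_ge0 Y) d0).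
apply: lee_nneseries => k; first by move=> *; exact: term_ge0.
move=> _; rewrite [in leRHS]mulrC EFinM fineK//.
rewrite -[leRHS]ge0_muleDr ?rV_ge0 ?rV_dist_ge0//.
rewrite lee_pmul2l// ?lte_fin ?c_gt0//.
apply: le_trans (le_rV_dist _ (Y `&` ball k)) _; rewrite leeD2l//.
exact: rV_dist_setIl.
Qed.

Lemma energy_le X : (energy X <= m X)%E.
Proof.
apply: le_trans (energy_dist X set0) _.
rewrite /energy eseries0 ?add0e; last by move=> k _ _; rewrite set0I rV_set0 mule0.
by apply: le_rV => x [[]|[]].
Qed.

(** As the sum is finite, a strict gain in one ball would make it strictly larger. *)
Lemma energy_eq X Y : (m X < +oo)%E ->
  (forall k, (m (X `&` ball k) <= m (Y `&` ball k))%E) ->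
  (energy Y <= energy X)%E -> forall k, (m (Y `&` ball k) <= m (X `&` ball k))%E.
Proof.
move=> Xoo XY YX j; rewrite leNgt; apply/negP => lt_XY.
have Xfin : energy X \is a fin_num.
  by rewrite ge0_fin_numE ?energy_ge0// (le_lt_trans (energy_le X)).
pose g := c j * (fine (m (Y `&` ball j)) - fine (m (X `&` ball j))).
have g0 : 0 < g.
  by rewrite mulr_gt0 ?c_gt0// subr_gt0 -lte_fin !fineK.
pose h k : \bar R := if k == j then g%:E else 0%E.
have h0 k : (0 <= h k)%E by rewrite /h; case: ifP => // _; rewrite lee_fin ltW.
have : (energy X + g%:E <= energy X)%E.
  apply: le_trans YX.
  apply: (@le_trans _ _ (energy X + \sum_(0 <= k <oo) h k)%E).
    rewrite leeD2l//; apply: le_trans (nneseries_lim_ge j.+1 (fun k _ _ => h0 k)).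
    have -> : g%:E = h j by rewrite /h eqxx.
    by rewrite big_nat_recr//= leeDr// sume_ge0.
  rewrite -nneseriesD; [|by move=> *; exact: term_ge0|by move=> *; exact: h0].
  apply: lee_nneseries => k; first by move=> *; rewrite adde_ge0// term_ge0.
  move=> _; rewrite /h; case: eqP => [->|_].
    rewrite -(fineK (ball_fin X j)) -(fineK (ball_fin Y j)) -!EFinM -EFinD lee_fin.
    by rewrite /g -/(c j); lra.
  by rewrite adde0 lee_pmul2l// ?lte_fin ?c_gt0.
by rewrite -[leRHS]adde0 leeD2lE// lee_fin leNgt g0.
Qed.

(** The symmetrization of [X `&` ball k] lies in that of [X] and in that of the ball,
which is the ball. *)
Lemma steiner_ball_le e X k : dotv e e = 1 -> finite_lebesgue X ->
  (m (X `&` ball k) <= m (steiner_unit e X `&` ball k))%E.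
Proof.
move=> e1 Xf; have Bf := finite_lebesgue_oball (R := R) (n := n) (radius k).
rewrite -(rV_steiner e1 (finite_lebesgueI Bf.1 Xf)); apply: le_rV => x Sx; split.
  by apply: steiner_unit_sub Sx => y [].
by rewrite -[ball k](steiner_oball e1); apply: steiner_unit_sub Sx => y [].
Qed.

Lemma rV_bigcup0 (F : nat -> set 'rV[R]_n.+1) :
  (forall k, m (F k) = 0%E) -> m (\bigcup_k F k) = 0%E.
Proof.
move=> F0; apply: rV_eq0.
apply: le_trans (outer_measure_sigma_subadditive ((borel_lebesgue n.+1)^*)%mu F) _.
by rewrite eseries0// => k _ _; exact: F0.
Qed.

Lemma rV_dist0 X Y : finite_lebesgue X -> finite_lebesgue Y -> m X = m Y ->
  m (Y `\` X) = 0%E -> rV_dist X Y = 0%E.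
Proof.
move=> Xf Yf XY YX0; rewrite (rV_distE _ Xf.1) YX0 adde0.
apply: rV_eq0; rewrite -YX0.
have := rV_setIC Y Xf.1; rewrite -XY (rV_setIC X Yf.1) setIC.
apply: lee_cancel_add => //; rewrite rV_fin_num// (le_lt_trans _ Xf.2)//.
by apply: le_rV; exact: subIsetr.
Qed.

(** A point of the symmetrized set that is missing from [A] has a ball around the
origin that contains it and whose section there is shorter than that of [A]. If
no such ball gains measure, then the missing points are negligible in the region
where its section is the shorter one. *)
Lemma steiner_axis_fixed A : measurable A -> (m A < +oo)%E ->
  (forall k, (m (steiner_unit (axis n) A `&` ball k) <= m (A `&` ball k))%E) ->
  m (steiner_unit (axis n) A `\` A) = 0%E.
Proof.
move=> mA Aoo le_ball; set S := steiner_unit _ A.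
have a1 := @axis_unit R n.
have Af : finite_lebesgue A by split => //; exact: borel_lebesgue_measurable.
pose T k : set 'rV[R]_n.+1 := [set y | (axis_section (ball k) (row_uncons y).2 <
  axis_section A (row_uncons y).2)%E].
have mT k : measurable (T k).
  rewrite -[X in measurable X]setTI; apply: measurable_lte => //;
  apply: (measurableT_comp (measurable_axis_section _)
    (measurableT_comp measurable_snd (@measurable_row_uncons R n))) => //.
  exact: measurable_oball.
apply: rV_eq0; rewrite -(@rV_bigcup0 (fun k => (ball k `&` T k) `\` A)).
  apply: le_rV => y [Sy Ay]; pose p := row_uncons y.
  have yp : y = row_cons p by rewrite row_unconsK.
  have pA : ((2 * `|p.1|)%:E < axis_section A p.2)%E.
    by apply/steiner_axisE; rewrite -yp.
  (* The segment of half-length [a] on the line through [y] contains [y] in its interior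
     and is shorter than the section of [A]; the ball is chosen to cut the line
     between [y] and the end of that segment. *)
  have [a ta aA] : exists2 a, `|p.1| < a & ((2 * a)%:E < axis_section A p.2)%E.
    move: pA; case: (axis_section A p.2) => [s|_|//].
      by rewrite lte_fin => ts; exists ((`|p.1| + s / 2) / 2); rewrite ?lte_fin; lra.
    by exists (`|p.1| + 1); rewrite ?ltry ?ltrDl.
  have a0 : 0 <= a by rewrite ltW// (le_lt_trans _ ta).
  have norm_row s : dotv (row_cons ((s : measurableTypeR R), p.2))
      (row_cons ((s : measurableTypeR R), p.2)) = s ^+ 2 + dotv p.2 p.2.
    rewrite !dotvE big_ord_recl !row_cons0 -expr2; congr (_ + _).
    by apply: eq_bigr => i _; rewrite !row_consS.
  have [k /andP[yk ka]] : exists k, enorm y < radius k < Num.sqrt (a ^+ 2 + dotv p.2 p.2).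
    apply: ex_radius; rewrite /enorm ltr_sqrt; last first.
      by rewrite ltr_wpDr ?dotv_ge0// exprn_gt0// (le_lt_trans _ ta).
    rewrite yp [p in row_cons p]surjective_pairing norm_row ltrD2r.
    by rewrite -(real_normK (num_real p.1)) ltr_pXn2r ?nnegrE.
  have k0 : 0 <= radius k by exact: le_trans (enorm_ge0 y) (ltW yk).
  exists k => //; split => //; split => //; apply: le_lt_trans aA.
  rewrite -[leRHS]lebesgue_centered_interval; last by rewrite lee_fin mulr_ge0.
  apply: (le_outer_measure ((wlength idfun)^*)%mu) => s /=.
  rewrite /ball/oball/= ltr_enorm// norm_row lte_fin ltr_pM2l// => sk.
  rewrite -(ltr_pXn2r (ltn0Sn 1)) ?nnegrE// real_normK ?num_real//.
  rewrite -(ltrD2r (dotv p.2 p.2)) (lt_le_trans sk)//.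
  rewrite -[leRHS]sqr_sqrtr ?addr_ge0 ?sqr_ge0 ?dotv_ge0//.
  by rewrite ler_pXn2r ?nnegrE ?sqrtr_ge0// ltW.
move=> k.
have Bf := finite_lebesgue_oball (R := R) (n := n) (radius k).
have Tf := borel_lebesgue_measurable (mT k).
have ABf := finite_lebesgueI Bf.1 Af.
have SAf := finite_lebesgue_steiner a1 ABf.
pose SA := steiner_unit (axis n) (A `&` ball k).
have SA_sub : SA `<=` S `&` ball k.
  move=> x Sx; split; first by apply: steiner_unit_sub Sx => y [].
  by rewrite -[ball k](steiner_oball a1); apply: steiner_unit_sub Sx => y [].
have SA_null : m ((S `&` ball k) `\` SA) = 0%E.
  apply: rV_eq0; have := rV_setD SAf.1 SA_sub.
  rewrite (rV_steiner a1 ABf) -[LHS]adde0 => /esym.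
  by apply: lee_cancel_add; [exact: ball_fin|exact: le_ball].
have BT_sub : ball k `&` T k `<=` S.
  move=> y [By Ty]; rewrite -[y]row_unconsK; apply/steiner_axisE; apply: lt_trans Ty.
  by apply/steiner_axisE; rewrite row_unconsK steiner_oball.
have SAT : SA `&` T k `<=` steiner_unit (axis n) (A `&` ball k `&` T k).
  move=> y [SAy Ty]; rewrite -[y]row_unconsK; apply/steiner_axisE.
  have : ((2 * `|(row_uncons y).1|)%:E < axis_section (A `&` ball k) (row_uncons y).2)%E.
    by apply/steiner_axisE; rewrite row_unconsK.
  move=> /lt_le_trans; apply.
  apply: (le_outer_measure ((wlength idfun)^*)%mu) => s ABs; split => //.
  by rewrite /T /mkset row_consK.
apply: rV_eq0.
(* Inside [T k] the ball lies in [S], hence up to a null set in [SA]. *)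
have BTA : (m (ball k `&` T k) <= m (A `&` ball k `&` T k))%E.
  apply: (@le_trans _ _ (m ((SA `&` T k) `|` ((S `&` ball k) `\` SA)))).
    apply: le_rV => x [Bx Tx]; have Sx := BT_sub _ (conj Bx Tx).
    by have [SAx|SAx] := pselect (SA x); [left|right].
  apply: le_trans (rV_setU _ _) _; rewrite SA_null adde0.
  by apply: le_trans (le_rV SAT) _; exact: rV_steiner_le.
have := rV_setIC (ball k `&` T k) Af.1; rewrite -[LHS]adde0 => /esym.
rewrite [_ `&` A]setIC setIA; apply: lee_cancel_add; last exact: BTA.
rewrite rV_fin_num// (le_lt_trans _ Aoo)//; apply: le_rV => x [[]] //.
Qed.

(** The equality case, reduced to a Borel set and to the axis. *)
Lemma energy_steiner_eq e X : dotv e e = 1 -> finite_lebesgue X ->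
  (energy (steiner_unit e X) <= energy X)%E -> rV_dist X (steiner_unit e X) = 0%E.
Proof.
move=> e1 Xf; have [A [B [mA mB AX XB BA0]]] := lebesgue_bracket Xf.1 Xf.2.
have Af : finite_lebesgue A.
  exact: finite_lebesgueS (borel_lebesgue_measurable mA) AX Xf.
have XA0 : rV_dist X A = 0%E.
  rewrite rV_distC rV_dist_sub//; apply: rV_eq0; rewrite -BA0; apply: le_rV.
  by move=> x [Xx Ax]; split => //; exact: XB.
set w := axis n - e; have we : reflection w (axis n) = e by exact: reflection_axis.
pose A' := reflection w @^-1` A.
have mA' : measurable A'.
  by apply: measurable_preimage => //; exact: measurable_reflection.
have A'f : finite_lebesgue A' by exact: finite_lebesgue_reflection.
move=> /(energy_eq Xf.2 (fun k => steiner_ball_le k e1 Xf)) le_ball.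
have ballr k : reflection w @^-1` ball k = ball k.
  by apply/seteqP; split => x; rewrite /ball/oball/= enorm_reflection.
have SA : steiner_unit e A = reflection w @^-1` steiner_unit (axis n) A'.
  by rewrite -we steiner_unit_reflection.
have A'E : A = reflection w @^-1` A'.
  by apply/seteqP; split => x; rewrite /A'/= reflectionK.
have SA'f := finite_lebesgue_steiner (axis_unit n) A'f.
have A'0 : m (steiner_unit (axis n) A' `\` A') = 0%E.
  apply: steiner_axis_fixed => // [|k]; first by case: A'f.
  rewrite -(rV_reflection w (finite_lebesgueI (finite_lebesgue_oball _).1 SA'f)).
  rewrite -(rV_reflection w (finite_lebesgueI (finite_lebesgue_oball _).1 A'f)).
  rewrite !preimage_setI ballr -SA -A'E.
  apply: (@le_trans _ _ (m (steiner_unit e X `&` ball k))).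
    by apply: le_rV => x [Sx Bx]; split => //; apply: steiner_unit_sub Sx.
  apply: le_trans (le_ball k) _.
  apply: le_trans (le_rV_dist _ (A `&` ball k)) _.
  rewrite -[leRHS]adde0 leeD2l// -XA0; exact: rV_dist_setIl.
have A'd : rV_dist A' (steiner_unit (axis n) A') = 0%E.
  by apply: rV_dist0 => //; rewrite rV_steiner// axis_unit.
apply: rV_eq0; apply: le_trans (rV_dist_triangle A _ _) _; rewrite XA0 add0e.
apply: le_trans (rV_dist_triangle (steiner_unit e A) _ _) _.
rewrite -[leRHS]adde0; apply: leeD.
  by rewrite SA A'E -A'd; exact: rV_dist_reflection.
by rewrite -XA0 [leRHS]rV_distC; exact: rV_dist_steiner.
Qed.

End energy.

(** * Topology of the space of directions *)

Section projective.
Context {R : realType} {n : nat}.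
Implicit Types (X Y W : set 'rV[R]_n.+1) (u : projective_space R n)
  (v w : set_type (@nonzero R n)).
Local Notation m := (@lebesgue_rV R n.+1).
Local Open Scope quotient_scope.

Definition normalize (x : 'rV[R]_n.+1) : 'rV[R]_n.+1 := (enorm x)^-1 *: x.

Lemma normalize_unit x : x != 0 -> dotv (normalize x) (normalize x) = 1.
Proof.
move=> x0; rewrite /normalize !dotv_lin -sqr_enorm expr2.
by have := x0; rewrite -enorm_eq0 => e0; field.
Qed.

Lemma nonzeroP v : set_val v != 0.
Proof. by have := set_valP v. Qed.

Lemma unit_dir_unit u : dotv (unit_dir u) (unit_dir u) = 1.
Proof. exact: (normalize_unit (nonzeroP (repr u))). Qed.

(** The representative chosen in a class spans the same line, so that its
normalization is the expected one up to sign. *)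
Lemma steiner_pi v X :
  steiner (\pi_(projective_space R n) v) X = steiner_unit (normalize (set_val v)) X.
Proof.
rewrite /steiner /unit_dir -/(normalize _).
set w := repr _; have : same_line w v by apply/eqmodP; rewrite reprK.
rewrite /same_line => /andP[/sub_rVP[a wv] _]; rewrite wv.
have a0 : a != 0 by apply: contra_neq (nonzeroP w) => a0; rewrite wv a0 scale0r.
rewrite /normalize enormZ scalerA invfM mulrAC.
have [a1|a1] := ltP 0 a.
  by rewrite gtr0_norm// mulVf ?mul1r// gt_eqF.
rewrite ler0_norm// invrN mulNr mulVf// mulN1r scaleNr; exact: steiner_unitN.
Qed.

Lemma normalize_near (x y : 'rV[R]_n.+1) : x != 0 -> y != 0 ->
  enorm (normalize y - normalize x) <= 2 * enorm (y - x) / enorm x.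
Proof.
move=> x0 y0; have ex : 0 < enorm x by rewrite enorm_gt0.
have ey : 0 < enorm y by rewrite enorm_gt0.
have -> : normalize y - normalize x = (enorm x)^-1 *: (y - x) +
    ((enorm x - enorm y) / (enorm x * enorm y)) *: y.
  apply/rowP => i; rewrite /normalize !mxE; field.
  by rewrite !gt_eqF.
apply: le_trans (enormD _ _) _; rewrite !enormZ gtr0_norm ?invr_gt0//.
rewrite normrM normfV (gtr0_norm (mulr_gt0 ex ey)).
have h : `|enorm x - enorm y| <= enorm (y - x).
  rewrite ler_norml; apply/andP; split.
    by have := enormD (y - x) x; rewrite subrK; lra.
  by have := enormD (x - y) y; rewrite subrK enormB; lra.
have -> : `|enorm x - enorm y| / (enorm x * enorm y) * enorm y =
    `|enorm x - enorm y| / enorm x by field; rewrite !gt_eqF.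
have := ler_wpM2r (ltW (_ : 0 < (enorm x)^-1)) h; rewrite invr_gt0 => /(_ ex).
by rewrite [2 * _ / _]mulrAC -mulrA; lra.
Qed.

(** Openness is tested on representatives, where [steiner_continuous] applies. *)
Lemma open_steiner X (P : set 'rV[R]_n.+1 -> Prop) : finite_lebesgue X ->
  (forall Y, finite_lebesgue Y -> P Y -> exists2 e : R, 0 < e &
    forall Z, finite_lebesgue Z -> (rV_dist Z Y <= e%:E)%E -> P Z) ->
  open [set u | P (steiner u X)].
Proof.
move=> Xf PP; rewrite /open/= /quotient_open.
rewrite openE => v /=; rewrite steiner_pi => Pv.
have v1 := normalize_unit (nonzeroP v).
have [e e0 PZ] := PP _ (finite_lebesgue_steiner v1 Xf) Pv.
have [d d0 dv] := steiner_continuous v1 Xf e0.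
have ev : 0 < enorm (set_val v) by rewrite enorm_gt0 nonzeroP.
pose r := d * enorm (set_val v) / 4 / n.+1%:R.
have r0 : 0 < r by rewrite !divr_gt0 ?mulr_gt0.
have : nbhs v (set_val @^-1` ball (set_val v) r).
  by apply: initial_continuous; exact: nbhsx_ballx.
apply: filterS => w [_ vw] /=; rewrite steiner_pi.
have w1 := normalize_unit (nonzeroP w).
apply: PZ; first exact: finite_lebesgue_steiner.
apply: dv => //; apply: le_lt_trans (normalize_near (nonzeroP v) (nonzeroP w)) _.
have wv : enorm (set_val w - set_val v) <= n.+1%:R * r.
  apply: enorm_le_coord => [|i]; first exact: ltW.
  by have := vw ord0 i; rewrite /ball/= distrC !mxE => /ltW.
have rE : n.+1%:R * r = d * enorm (set_val v) / 4 by rewrite /r mulrC divfK// pnatr_eq0.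
have dv0 : 0 < d * enorm (set_val v) by rewrite mulr_gt0.
by rewrite ltr_pdivrMr//; move: wv; rewrite rE; lra.
Qed.

Lemma open_steiner_dist_lt X W (e : R) : finite_lebesgue X -> finite_lebesgue W ->
  open [set u | (rV_dist (steiner u X) W < e%:E)%E].
Proof.
move=> Xf Wf; apply: (open_steiner (P := fun Y => (rV_dist Y W < e%:E)%E)) => // Y Yf.
have Yfin : rV_dist Y W \is a fin_num.
  by rewrite rV_fin_num// rV_dist_lty//; [case: Yf|case: Wf].
rewrite -(fineK Yfin) lte_fin => Ye; exists ((e - fine (rV_dist Y W)) / 2).
  by rewrite divr_gt0// subr_gt0.
move=> Z Zf ZY; apply: le_lt_trans (rV_dist_triangle Y _ _) _.
apply: le_lt_trans (leeD ZY (lexx _)) _.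
by rewrite -(fineK Yfin) -EFinD lte_fin /=; lra.
Qed.

Lemma open_steiner_dist_gt0 X W : finite_lebesgue X -> finite_lebesgue W ->
  open [set u | (0 < rV_dist W (steiner u X))%E].
Proof.
move=> Xf Wf; apply: (open_steiner (P := fun Y => (0 < rV_dist W Y)%E)) => // Y Yf.
have Yfin : rV_dist W Y \is a fin_num.
  by rewrite rV_fin_num// rV_dist_lty//; [case: Wf|case: Yf].
rewrite -(fineK Yfin) lte_fin => Y0; exists (fine (rV_dist W Y) / 2).
  by rewrite divr_gt0.
move=> Z Zf ZY; rewrite lt0e rV_dist_ge0 andbT; apply/eqP => WZ0.
have := rV_dist_triangle Z W Y; rewrite WZ0 add0e => /le_trans /(_ ZY).
by rewrite -(fineK Yfin) lee_fin /=; lra.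
Qed.

(** Each line has a spanning vector in one of the compact faces
[x_j = 1, |x_i| <= 1] of the cube. *)
Definition cube_face (j : 'I_n.+1) : set 'rV[R]_n.+1 := [set x | forall i,
  (if i == j then [set 1] else `[(-1), 1]%classic) (x ord0 i)].

Lemma cube_face_neq0 j x : cube_face j x -> x != 0.
Proof.
move=> /(_ j); rewrite eqxx => xj; apply/eqP => x0.
by move: xj; rewrite /= x0 mxE => /esym/eqP; rewrite oner_eq0.
Qed.

Lemma compact_cube_face j : compact (cube_face j).
Proof.
apply: (@rV_compact R n.+1 (fun i => if i == j then [set 1] else `[(-1), 1]%classic)).
move=> i; case: eqP => _; first exact: compact_set1.
exact: segment_compact.
Qed.

(** The projection to lines, extended to all vectors by a default value at [0], so that
compactness can be transported from sets of vectors. *)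
Definition line (x : 'rV[R]_n.+1) : projective_space R n :=
  if pselect (nonzero x) is left x0 then \pi_(projective_space R n) (SigSub (mem_set x0))
  else point.

Lemma lineE v : line (set_val v) = \pi_(projective_space R n) v.
Proof.
rewrite /line; case: pselect => [x0|/(_ (nonzeroP v))//].
by congr (\pi _); apply/val_inj.
Qed.

Lemma line_continuous x : x != 0 -> {for x, continuous line}.
Proof.
move=> x0; pose v : set_type (@nonzero R n) := SigSub (mem_set (x0 : nonzero x)).
have -> : x = set_val v by [].
move=> U; rewrite lineE nbhsE => -[V [oV Vv] VU].
have : open ((\pi_(projective_space R n) : set_type (@nonzero R n) -> _) @^-1` V) := oV.
move=> -[D oD DE].
have Dv : D (set_val v) by rewrite -[D _]/((set_val @^-1` D) v) DE.
have e0 : 0 < enorm (set_val v) / n.+2%:R by rewrite divr_gt0// enorm_gt0 nonzeroP.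
have : nbhs (set_val v) (D `&` ball (set_val v) (enorm (set_val v) / n.+2%:R)).
  by apply: filterI; [exact: open_nbhs_nbhs|exact: nbhsx_ballx].
apply: filterS => y [Dy [_ vy]].
have y0 : y != 0.
  apply/eqP => y0; have : enorm (set_val v) <= n.+1%:R * (enorm (set_val v) / n.+2%:R).
    apply: enorm_le_coord => [|i]; first exact: ltW.
    by have := vy ord0 i; rewrite y0 /ball/= mxE subr0 => /ltW.
  apply/negP; rewrite -ltNge mulrCA gtr_pMr ?enorm_gt0 ?nonzeroP//.
  by rewrite ltr_pdivrMr// mul1r ltr_nat.
pose w : set_type (@nonzero R n) := SigSub (mem_set (y0 : nonzero y)).
apply: VU; have -> : y = set_val w by [].
by rewrite lineE -[V _]/((\pi_(projective_space R n) @^-1` V) w) -DE.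
Qed.

(** Dividing a vector by its largest coordinate moves it into a face of the cube. *)
Lemma compact_projective : compact [set: projective_space R n].
Proof.
rewrite (_ : setT = \big[setU/set0]_(j <- index_enum 'I_n.+1) (line @` cube_face j)).
  apply: bigsetU_compact => j _; apply: continuous_compact; last exact: compact_cube_face.
  apply: continuous_in_subspaceT => x; rewrite inE => /cube_face_neq0.
  exact: line_continuous.
apply/seteqP; split => // u _; rewrite -bigcup_seq.
pose x := set_val (repr u); have x0 : x != 0 := nonzeroP _.
pose j := [arg max_(i > ord0) `|x ord0 i|]%O.
have jmax i : `|x ord0 i| <= `|x ord0 j|.
  by rewrite /j; case: arg_maxP => // k _; exact.
have xj0 : x ord0 j != 0.
  apply: contra_neq x0 => xj0; apply/rowP => i; rewrite mxE.
  by apply/eqP; rewrite -normr_le0 (le_trans (jmax i))// xj0 normr0.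
have y0 : (x ord0 j)^-1 *: x != 0 by rewrite scaler_eq0 invr_eq0 negb_or xj0.
pose w : set_type (@nonzero R n) := SigSub (mem_set (y0 : nonzero _)).
exists j; first exact: mem_index_enum.
exists ((x ord0 j)^-1 *: x).
  move=> i; case: eqP => [->|_] /=; first by rewrite mxE mulVf.
  rewrite in_itv/= -ler_norml mxE normrM normfV mulrC ler_pdivrMr ?normr_gt0//.
  by rewrite mul1r.
have -> : (x ord0 j)^-1 *: x = set_val w by [].
rewrite lineE -[RHS]reprK; apply/eqmodP; rewrite /= /same_line.
by apply/eqmxP/eqmx_scale; rewrite invr_eq0.
Qed.

End projective.

(** * Directions charged by the distribution *)

Section charged.
Context {R : realType} {n : nat} (mu : probability (projective_space R n) R).
Local Notation P := (projective_space R n).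
Local Notation m := (@lebesgue_rV R n.+1).

(** The topological support of [mu]. *)
Definition charged (u : P) := forall U : set P, open U -> U u -> (0 < mu U)%E.

Lemma open_measurable_projective (U : set P) : open U -> measurable U.
Proof. by move=> oU; exact: sub_sigma_algebra. Qed.

(** Otherwise the closed set, being compact, would be covered by finitely many
null open sets. *)
Lemma closed_charged (F : set P) : closed F -> mu F != 0%E ->
  exists2 u, F u & charged u.
Proof.
move=> cF /eqP muF; apply: contrapT => /forall2NP noF; apply: muF.
have {noF} /choice[U UP] : forall u : P, exists U : set P,
    open U /\ (F u -> U u /\ mu U = 0%E).
  move=> u; have [Fu|Fu] := pselect (F u); last by exists set0; split => //; exact: open0.
  have [//|/existsNP[U /not_implyP[oU /not_implyP[Uu U0]]]] := noF u.
  exists U; split => // _; split => //; apply: contrapT => /eqP U0'.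
  by apply: U0; rewrite lt0e U0'/=.
have : compact F by exact: subclosed_compact cF compact_projective _.
rewrite compact_cover => /(_ _ F U)[u _|u Fu|D DF FD].
- by case: (UP u).
- by exists u => //; case: (UP u) => _ /(_ Fu)[].
apply/negligibleP.
  rewrite -[F]setCK; apply: measurableC; apply: open_measurable_projective.
  exact: closed_openC.
apply: negligibleS FD _; rewrite /cover bigcup_seq big_seq.
elim/big_rec : _ => [|u A uD A0]; first exact: negligible_set0.
apply: negligibleU => //; have Fu : F u by have := DF _ uD; rewrite inE.
have [oU /(_ Fu)[_ U0]] := UP u.
by apply/negligibleP => //; exact: open_measurable_projective.
Qed.

End charged.

Section words.
Context {R : realType} {n : nat}.
Local Notation P := (projective_space R n).
Local Notation m := (@lebesgue_rV R n.+1).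
Implicit Types (X Y Z : set 'rV[R]_n.+1) (s t : seq P) (u : P).

Lemma steiner_seq_cat X s t : steiner_seq X (s ++ t) = steiner_seq (steiner_seq X s) t.
Proof. by rewrite /steiner_seq foldl_cat. Qed.

Lemma finite_lebesgue_seq s X : finite_lebesgue X -> finite_lebesgue (steiner_seq X s).
Proof.
elim: s X => //= u s IH X Xf; apply: IH.
exact/finite_lebesgue_steiner/Xf/unit_dir_unit.
Qed.

Lemma rV_seq s X : finite_lebesgue X -> m (steiner_seq X s) = m X.
Proof.
elim: s X => //= u s IH X Xf; have u1 := unit_dir_unit u.
by rewrite IH ?rV_steiner//; exact: finite_lebesgue_steiner.
Qed.

Lemma rV_dist_seq s X Y : finite_lebesgue X -> finite_lebesgue Y ->
  (rV_dist (steiner_seq X s) (steiner_seq Y s) <= rV_dist X Y)%E.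
Proof.
elim: s X Y => //= u s IH X Y Xf Yf; have u1 := unit_dir_unit u.
apply: le_trans (IH _ _ _ _) _; [exact: finite_lebesgue_steiner..|].
exact: rV_dist_steiner.
Qed.

Lemma seq_rearrangement s X : finite_lebesgue X ->
  steiner_seq (rearrangement X) s = rearrangement X.
Proof.
move=> Xf; elim: s => //= u s IH; have u1 := unit_dir_unit u.
by rewrite [steiner u _](steiner_rearrangement u1 Xf.2).
Qed.

(** The limit is fixed by the symmetrizations, which contract the distance. *)
Lemma rV_dist_seq_rearrangement s X Y : finite_lebesgue X -> finite_lebesgue Y ->
  (rV_dist (steiner_seq X s) (rearrangement Y) <= rV_dist X (rearrangement Y))%E.
Proof.
move=> Xf Yf; rewrite -{1}(seq_rearrangement s Yf).
by apply: rV_dist_seq => //; exact: (finite_lebesgue_rearrangement Yf.2).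
Qed.

(** What the orbit of a good set has in common, by [thick_steiner_sub]. *)
Lemma good_seq X s : good X -> [/\ measurable (steiner_seq X s),
  forall r, X `<=` oball r -> steiner_seq X s `<=` oball r &
  forall h, (m (thick h (steiner_seq X s)) <= m (thick h X))%E].
Proof.
move=> [mX _ _]; elim: s X mX => [|u s IH] X mX; first by split.
have u1 := unit_dir_unit u.
have mS : measurable (steiner u X) by exact: measurable_steiner_unit.
have [mSs Ssr Ssh] := IH _ mS; split => //= [r Xr|h].
  by apply: Ssr; rewrite -[oball r](steiner_oball u1); exact: steiner_unit_sub.
apply: le_trans (Ssh h) _; apply: le_trans (le_rV _) (rV_steiner_le u1 _).
exact: thick_steiner_sub.
Qed.

(** A union of grid cells that covers a member [Y] of the orbit and lies in
[thick h Y] exceeds [Y] by at most [m (thick h X) - m X]. *)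
Lemma orbit_totally_bounded X (e : R) : good X -> 0 < e ->
  exists (I : finType) (Z : I -> set 'rV[R]_n.+1), (forall i, measurable (Z i)) /\
    forall s, exists i, steiner_seq X s `<=` Z i /\
      (m (Z i `\` steiner_seq X s) <= e%:E)%E.
Proof.
move=> gX e0; have Xf := good_finite gX; have [_ [r Xr] /(_ _ e0)[h h0 hX]] := gX.
have [I [Z [mZ ZP]]] := @finite_grid_cover R n.+1 r h h0.
exists I, Z; split => // s; have [mS /(_ _ Xr) Sr Sh] := good_seq s gX.
have [i [Si iS]] := ZP _ (subset_trans Sr (@oball_sub_cube _ _ _)).
exists i; split => //.
apply: (@le_trans _ _ (m (thick h (steiner_seq X s) `\` steiner_seq X s))).
  by apply: le_rV => x [/iS].
have Sf := finite_lebesgue_seq s Xf.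
rewrite -(leeD2lE _ _ (rV_fin_num Sf.2)).
rewrite -(rV_setD Sf.1 (sub_thick h0)) rV_seq//.
exact: le_trans (Sh h) hX.
Qed.

Lemma ultra_finite (T : Type) (G : set_system T) (I : finType) (F : I -> set T) :
  UltraFilter G -> (forall x, exists i, F i x) -> exists i, G (F i).
Proof.
move=> UG cF; apply: contrapT => /forallNP noF.
have GC i : G (~` F i) by have [/noF|] := in_ultra_setVsetC (F i) UG.
have GF : ProperFilter G by exact: ultra_proper.
have [x xF] := filter_ex (filter_forall _ GC).
by have [i /(xF i)] := cF x.
Qed.

(** At each scale the ultrafilter selects one of the finitely many outer
approximations; the limit is the intersection of the selected ones. *)
Lemma ultra_orbit_limit X (G : set_system (seq P)) : good X -> UltraFilter G ->
  exists2 Z, finite_lebesgue Z & forall e : R, 0 < e ->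
    G [set s | (rV_dist (steiner_seq X s) Z <= e%:E)%E].
Proof.
move=> gX UG; have GF : ProperFilter G by exact: ultra_proper.
have Xf := good_finite gX.
have /choice[Z ZP] : forall j : nat, exists Z : set 'rV[R]_n.+1, measurable Z /\
    G [set s | steiner_seq X s `<=` Z /\
      (m (Z `\` steiner_seq X s) <= (j.+1%:R^-1)%:E)%E].
  move=> j; have j0 : 0 < j.+1%:R^-1 :> R by rewrite invr_gt0.
  have [I [Z [mZ ZP]]] := orbit_totally_bounded gX j0.
  have [i Gi] := ultra_finite UG ZP.
  by exists (Z i); split.
pose W j := \bigcap_(i < j.+1) Z i.
pose L := \bigcap_j Z j.
have mW j : measurable (W j).
  by apply: fin_bigcap_measurable => [|i _]; [exact: finite_II|case: (ZP i)].
have mL : measurable L by apply: bigcapT_measurable => j; case: (ZP j).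
have GW j : G [set s | steiner_seq X s `<=` W j /\
    (m (W j `\` steiner_seq X s) <= (j.+1%:R^-1)%:E)%E].
  have GZ : G [set s | forall i : 'I_j.+1, steiner_seq X s `<=` Z i].
    apply: (filter_forall (f := fun (i : 'I_j.+1) s => steiner_seq X s `<=` Z i)) => i.
    by apply: filterS (ZP i).2 => s [].
  apply: filterS (filterI GZ (ZP j).2) => s [sZ [_ sj]]; split.
    by move=> x sx i /= ij; exact: (sZ (Ordinal ij)).
  by apply: le_trans sj; apply: le_rV => x [Wx sx]; split => //; exact: (Wx j (ltnSn j)).
have W0fin : (m (W 0%N) < +oo)%E.
  have [s [sW sm]] := filter_ex (GW 0%N).
  rewrite (rV_setD (finite_lebesgue_seq s Xf).1 sW) rV_seq//.
  by rewrite lte_add_pinfty ?Xf.2// (le_lt_trans sm)// ltry.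
have LW j : L `<=` W j by move=> x Lx i _; exact: Lx.
exists L.
  split; first exact: borel_lebesgue_measurable.
  exact: le_lt_trans (le_rV (LW 0%N)) W0fin.
move=> e e0; have e20 : 0 < e / 2 by rewrite divr_gt0.
have WS i j : (i <= j)%N -> W j `<=` W i.
  by move=> ij x Wx k /= ki; apply: Wx => /=; exact: leq_trans ki _.
have [||||k Wk] := @rV_small_tail R n.+1 (fun j => W j `\` L) (e / 2) _ _ _ _ e20.
- by apply: le_lt_trans W0fin; apply: le_rV => x [].
- by move=> k; exact: measurableD.
- by move=> i j ij x [Wx Lx]; split => //; exact: WS Wx.
- apply/seteqP; split => // x Wx; have [_] := Wx 0%N I; apply => j _.
  by have [/(_ j (ltnSn j))] := Wx j I.
near \oo => j.
have kj : (k <= j)%N by near: j; exact: nbhs_infty_ge.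
have je : j.+1%:R^-1 <= e / 2.
  by apply: ltW; near: j; exact: (near_infty_natSinv_lt (PosNum e20)).
apply: filterS (GW j) => s [sW sm] /=.
apply: le_trans (rV_dist_triangle (W j) _ _) _; rewrite [e]splitr EFinD.
apply: leeD; first by rewrite rV_dist_sub// (le_trans sm)// lee_fin.
rewrite rV_distC rV_dist_sub//; apply: le_trans Wk.
by apply: le_rV => x [Wx Lx]; split => //; exact: WS Wx.
Unshelve. all: by end_near. Qed.

End words.

(** * Words of directions that round every set of an orbit *)

Section rounding.
Context {R : realType} {n : nat} (mu : probability (projective_space R n) R).
Local Notation P := (projective_space R n).
Local Notation m := (@lebesgue_rV R n.+1).
Implicit Types (X Y Z : set 'rV[R]_n.+1) (s t : seq P) (u : P) (e : R).

Hypothesis moved : forall X, lebesgue_measurable X -> (m X < +oo)%E ->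
  (0 < m (X `+` rearrangement X))%E ->
  (0 < mu [set u | (0 < m (X `+` steiner u X))%E])%E.

(** The directions that move [X] form an open set, which closed sets exhaust; one of
these is not null and so contains a charged direction. *)
Lemma ex_charged_moved X : finite_lebesgue X -> (0 < rV_dist X (rearrangement X))%E ->
  exists2 u, charged mu u & (0 < rV_dist X (steiner u X))%E.
Proof.
move=> Xf X0; have E0 := moved Xf.1 Xf.2 X0.
pose F k : set P := ~` [set u | (rV_dist (steiner u X) X < (k.+1%:R^-1)%:E)%E].
have oF k : open [set u | (rV_dist (steiner u X) X < (k.+1%:R^-1)%:E)%E].
  exact: open_steiner_dist_lt.
have [k Fk] : exists k, mu (F k) != 0%E.
  apply: contrapT => /forallNP F0; move: E0.
  rewrite (_ : mu _ = 0%E) ?ltxx//; apply/negligibleP.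
    by apply: open_measurable_projective; exact: (open_steiner_dist_gt0 Xf Xf).
  apply: (@negligibleS _ _ _ _ (\bigcup_k F k)).
    move=> u; rewrite /= -/(rV_dist _ _) => Xu0.
    have fin : rV_dist X (steiner u X) \is a fin_num.
      rewrite rV_fin_num// rV_dist_lty ?Xf.2//.
      by have [] := finite_lebesgue_steiner (unit_dir_unit u) Xf.
    have e0 : 0 < fine (rV_dist X (steiner u X)) by rewrite -lte_fin fineK.
    near \oo => k; exists k => //; apply/negP; rewrite -leNgt rV_distC -(fineK fin).
    by rewrite lee_fin ltW//; near: k; exact: (near_infty_natSinv_lt (PosNum e0)).
  apply: negligible_bigcup => k; apply/negligibleP.
    by apply: measurableC; apply: open_measurable_projective.
  by apply/eqP; rewrite -[_ == _]negbK; exact/negP/F0.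
have [|u Fu uc] := closed_charged _ Fk; first exact: open_closedC.
exists u => //; rewrite rV_distC; apply: lt_le_trans (_ : (k.+1%:R^-1)%:E <= _)%E.
  by rewrite lte_fin invr_gt0.
by rewrite leNgt; exact/negP.
Unshelve. all: by end_near. Qed.

Definition charged_word s := forall u, u \in s -> charged mu u.

Lemma charged_word_cat s t : charged_word s -> charged_word t -> charged_word (s ++ t).
Proof. by move=> sc tc u; rewrite mem_cat => /orP[/sc|/tc]. Qed.

(** A limit of images of [X] along which the energy tends to its supremum is fixed
by every charged direction, as these cannot increase its energy further; hence it
is a ball. *)
Lemma charged_approach X s0 e : good X -> 0 < e ->
  exists2 s, charged_word s &
    (rV_dist (steiner_seq X (s0 ++ s)) (rearrangement X) <= e%:E)%E.
Proof.
move=> gX e0; have Xf := good_finite gX.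
have Sf t : finite_lebesgue (steiner_seq X t) by exact: finite_lebesgue_seq.
pose En t := energy (steiner_seq X t).
pose S := [set En (s0 ++ s) | s in charged_word].
pose a := ereal_sup S.
have aS s : charged_word s -> (En (s0 ++ s) <= a)%E.
  by move=> sc; apply: ereal_sup_ubound; exists s.
have afin : a \is a fin_num.
  rewrite ge0_fin_numE; last first.
    by apply: le_trans (aS [::] _) => //; exact: energy_ge0.
  apply: le_lt_trans Xf.2; apply: ge_ereal_sup => _ [s _ <-].
  by apply: le_trans (energy_le _) _; rewrite rV_seq.
pose O j := [set t | exists s, [/\ t = s0 ++ s, charged_word s &
  (a - (j.+1%:R^-1)%:E < En t)%E]].
have OF : ProperFilter (filter_from setT O).
  apply: filter_from_proper.
    apply: filter_fromT_filter; first by exists 0%N.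
    move=> i j; exists (maxn i j) => t [s [ts sc at_]]; split; exists s; split => //;
      apply: le_lt_trans at_; rewrite leeD2l// leeN2 lee_fin lef_pV2 ?posrE//;
      by rewrite ler_nat ltnS ?leq_maxl ?leq_maxr.
  move=> j _; have j0 : 0 < j.+1%:R^-1 :> R by rewrite invr_gt0.
  have [_ [s sc <-] sa] := ub_ereal_sup_adherent j0 afin.
  by exists (s0 ++ s); exists s.
have [G [UG OG]] := ultraFilterLemma OF.
have GF : ProperFilter G by exact: ultra_proper.
have [Z Zf ZG] := ultra_orbit_limit gX UG.
have near f : 0 < f -> exists s, [/\ charged_word s, (a <= En (s0 ++ s) + f%:E)%E &
    (rV_dist (steiner_seq X (s0 ++ s)) Z <= f%:E)%E].
  move=> f0; near \oo => j.
  have jf : j.+1%:R^-1 <= f.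
    by apply: ltW; near: j; exact: (near_infty_natSinv_lt (PosNum f0)).
  have GO : G (O j) by apply: OG; exists j.
  have [t [[s [-> sc sa]] tZ]] := filter_ex (filterI GO (ZG _ f0)).
  exists s; split => //; rewrite -leeBlDr//; apply: le_trans (ltW sa).
  by rewrite leeD2l// leeN2 lee_fin.
have aZ : (a <= energy Z)%E.
  apply/lee_addgt0Pr => f f0; have f20 : 0 < f / 2 by rewrite divr_gt0.
  have [s [sc sa sZ]] := near _ f20; apply: le_trans sa _.
  rewrite [in leRHS](splitr f) EFinD addeA leeD2r//; apply: le_trans (energy_dist _ Z) _.
  by rewrite leeD2l.
have Zu u : charged mu u -> rV_dist Z (steiner u Z) = 0%E.
  move=> uc; have u1 := unit_dir_unit u.
  apply: energy_steiner_eq => //; apply: le_trans aZ.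
  apply/lee_addgt0Pr => f f0; have [s [sc _ sZ]] := near _ f0.
  apply: le_trans (energy_dist _ (steiner u (steiner_seq X (s0 ++ s)))) _.
  apply: leeD.
    have -> : steiner u (steiner_seq X (s0 ++ s)) = steiner_seq X (s0 ++ (s ++ [:: u])).
      by rewrite catA [RHS]steiner_seq_cat.
    apply: aS; apply: charged_word_cat => // v; rewrite inE => /eqP ->.
    exact: uc.
  by apply: le_trans (rV_dist_steiner u1 Zf (Sf _)) _; rewrite rV_distC.
have Z0 : rV_dist Z (rearrangement Z) = 0%E.
  apply/eqP; rewrite eq_le rV_dist_ge0 andbT leNgt; apply/negP => Z0.
  by have [u /Zu ->] := ex_charged_moved Zf Z0; rewrite ltxx.
have ZX : m Z = m X.
  apply/eqP; rewrite eq_le; apply/andP; split; apply/lee_addgt0Pr => f f0;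
    have [s [sc _ sZ]] := near _ f0; rewrite -(rV_seq (s0 ++ s) Xf).
    apply: le_trans (le_rV_dist _ (steiner_seq X (s0 ++ s))) _.
    by rewrite leeD2l// rV_distC.
  by apply: le_trans (le_rV_dist _ Z) _; rewrite leeD2l.
have [s [sc _ sZ]] := near _ e0; exists s => //.
apply: le_trans (rV_dist_triangle Z _ _) _.
by rewrite -(eq_rearrangement ZX) Z0 adde0.
Unshelve. all: by end_near. Qed.

(** One word for finitely many sets: words are concatenated, and what is close to the
ball stays close to it. *)
Lemma charged_approach_seq X (l : seq (seq P)) e : good X -> 0 < e ->
  exists2 s, charged_word s & forall t, t \in l ->
    (rV_dist (steiner_seq X (t ++ s)) (rearrangement X) <= e%:E)%E.
Proof.
move=> gX e0; have Xf := good_finite gX; elim: l => [|t l [s sc sl]].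
  by exists [::].
have [s' sc' s'X] := charged_approach (t ++ s) gX e0.
exists (s ++ s'); first exact: charged_word_cat.
move=> r; rewrite inE catA => /orP[/eqP -> //|/sl rs].
apply: le_trans rs; rewrite [steiner_seq X _]steiner_seq_cat.
by apply: rV_dist_seq_rearrangement => //; exact: finite_lebesgue_seq.
Qed.

Fixpoint word_in (Us : seq (set P)) s : Prop :=
  match Us, s with
  | [::], [::] => True
  | U :: Us', u :: s' => U u /\ word_in Us' s'
  | _, _ => False
  end.

Definition positive_opens (Us : seq (set P)) :=
  forall U, U \in Us -> open U /\ (0 < mu U)%E.

(** Symmetrization is continuous in its direction and contracts the distance, so the
letters of a word may vary in small open sets, which have positive measure. *)
Lemma word_nbhs (l : seq (set 'rV[R]_n.+1)) s e :
  (forall Y, Y \in l -> finite_lebesgue Y) -> charged_word s -> 0 < e ->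
  exists2 Us, positive_opens Us & forall s', word_in Us s' -> forall Y, Y \in l ->
    (rV_dist (steiner_seq Y s') (steiner_seq Y s) <= e%:E)%E.
Proof.
elim: s l e => [|u s IH] l e lf sc e0.
  by exists [::] => // -[|//] _ Y _; rewrite rV_distxx lee_fin ltW.
have e20 : 0 < e / 2 by rewrite divr_gt0.
have lf' Y : Y \in map (steiner u) l -> finite_lebesgue Y.
  by move=> /mapP[Z /lf Zf ->]; exact: (finite_lebesgue_steiner (unit_dir_unit u)).
have [|Us Uso Us_s] := IH (map (steiner u) l) (e / 2) lf' _ e20.
  by move=> v vs; apply: sc; rewrite inE vs orbT.
pose U := \bigcap_(Y in [set` l])
  [set v : P | (rV_dist (steiner v Y) (steiner u Y) < (e / 2)%:E)%E].
have oU : open U.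
  rewrite /U bigcap_seq big_seq; elim/big_ind : _ => [||Y Yl].
  - exact: openT.
  - exact: openI.
  - apply: open_steiner_dist_lt; first exact: lf.
    by apply: (finite_lebesgue_steiner (unit_dir_unit u)); exact: lf.
have Uu : U u by move=> Y _ /=; rewrite rV_distxx lte_fin.
exists (U :: Us).
  move=> V; rewrite inE => /orP[/eqP ->|/Uso//]; split => //.
  by apply: sc oU Uu; rewrite inE eqxx.
move=> [//|v s'] [Uv s'Us] Y Yl /=.
apply: le_trans (rV_dist_triangle (steiner_seq (steiner u Y) s') _ _) _.
rewrite [e]splitr EFinD; apply: leeD; last first.
  by apply: Us_s => //; exact: map_f.
apply: le_trans (rV_dist_seq _ _ _) _.
- exact/(finite_lebesgue_steiner (unit_dir_unit v))/lf.
- exact/(finite_lebesgue_steiner (unit_dir_unit u))/lf.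
- by apply: ltW; exact: (Uv Y).
Qed.

(** As the orbit is totally bounded, a word that works for a finite net works for
the whole orbit. *)
Lemma ex_rounding_opens X e : good X -> 0 < e ->
  exists2 Us, positive_opens Us & forall t s, word_in Us s ->
    (rV_dist (steiner_seq X (t ++ s)) (rearrangement X) <= e%:E)%E.
Proof.
move=> gX e0; have Xf := good_finite gX; have e40 : 0 < e / 4 by rewrite divr_gt0.
have Sf t : finite_lebesgue (steiner_seq X t) by exact: finite_lebesgue_seq.
have [I [Z [mZ ZP]]] := orbit_totally_bounded gX e40.
pose Q i t := steiner_seq X t `<=` Z i /\ (m (Z i `\` steiner_seq X t) <= (e / 4)%:E)%E.
have /choice[rep repP] : forall i, exists t, (exists t', Q i t') -> Q i t.
  by move=> i; have [[t Qt]|noQ] := pselect (exists t, Q i t); [exists t|exists [::]].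
pose l := [seq rep i | i <- index_enum I].
have [s sc sl] := charged_approach_seq l gX e40.
have [|Us Uso Us_s] := @word_nbhs [seq steiner_seq X t | t <- l] s (e / 4) _ sc e40.
  by move=> _ /mapP[t _ ->].
exists Us => // t s' s'Us; have [i Qit] := ZP t.
have Qir : Q i (rep i) by apply: repP; exists t.
have il : rep i \in l by apply: map_f; exact: mem_index_enum.
have tr : (rV_dist (steiner_seq X t) (steiner_seq X (rep i)) <= (e / 4 + e / 4)%:E)%E.
  apply: le_trans (rV_dist_triangle (Z i) _ _) _; rewrite EFinD; apply: leeD.
    by rewrite rV_dist_sub; case: Qit.
  by rewrite rV_distC rV_dist_sub; case: Qir.
rewrite steiner_seq_cat.
apply: le_trans (rV_dist_triangle (steiner_seq (steiner_seq X (rep i)) s') _ _) _.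
apply: (@le_trans _ _ ((e / 4 + e / 4)%:E + ((e / 4)%:E + (e / 4)%:E))%E); last first.
  by rewrite -!EFinD lee_fin; lra.
apply: leeD; first by apply: le_trans tr; exact: rV_dist_seq.
apply: le_trans (rV_dist_triangle (steiner_seq (steiner_seq X (rep i)) s) _ _) _.
apply: leeD; first by apply: Us_s => //; exact: map_f.
by rewrite -steiner_seq_cat; exact: sl.
Qed.

End rounding.

(** * Independent directions *)

Section independent_blocks.
Context {d d' : measure_display} {Omega : measurableType d} {T : measurableType d'}
  {R : realType} (Pr : probability Omega R) (S : nat -> {RV Pr >-> T}).
Hypothesis S_indep : mutually_independent S.

Let measurable_S i (B : set T) : measurable B -> measurable (S i @^-1` B).
Proof. exact: (measurable_preimage (measurable_funPT (S i))). Qed.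

Lemma mutually_independent_seq (s : seq nat) (B : nat -> set T) : uniq s ->
  (forall i, measurable (B i)) ->
  Pr (\bigcap_(i in [set` s]) S i @^-1` B i) = (\prod_(i <- s) Pr (S i @^-1` B i))%E.
Proof.
move=> us mB; pose J := [fset i in s]%fset.
have JE : perm_eq J s by apply: uniq_perm => // i; rewrite in_fset.
rewrite -(perm_big _ JE) -S_indep//; congr (Pr _).
by apply: eq_bigcapl; split => i; rewrite /= in_fset.
Qed.

Variables (k : nat) (B : nat -> set T) (p : R).
Hypothesis mB : forall i, measurable (B i).

Let block j := iota (j * k) k.

Hypothesis p_block : forall j, (\prod_(i <- block j) Pr (S i @^-1` B i) = p%:E)%E.

Let event (s : seq nat) := \bigcap_(i in [set` s]) S i @^-1` B i.

Let measurable_event s : measurable (event s).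
Proof. by apply: fin_bigcap_measurable => // i _; exact: measurable_S. Qed.

Let miss M := \bigcap_(j < M) ~` event (block j).

Let measurable_miss M : measurable (miss M).
Proof.
by apply: fin_bigcap_measurable => [|j _]; [exact: finite_II|exact: measurableC].
Qed.

(** Induction on the number of blocks: to miss one more block is to subtract the case
where it is hit, in which its indices join [s]. *)
Lemma miss_blocks M s : uniq s -> (forall i, i \in s -> (M * k <= i)%N) ->
  Pr (event s `&` miss M) = (\prod_(i <- s) Pr (S i @^-1` B i) * ((1 - p) ^+ M)%:E)%E.
Proof.
elim: M s => [|M IH] s us sM.
  rewrite expr0 mule1 -mutually_independent_seq//; congr (Pr _).
  by rewrite -[RHS]setIT; congr (_ `&` _); apply/seteqP; split.
have sM' i : i \in s -> (M * k <= i)%N.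
  by move/sM; apply: leq_trans; rewrite leq_mul2r leqnSn orbT.
have sub : event s `&` miss M.+1 =
    (event s `&` miss M) `\` (event (block M ++ s) `&` miss M).
  apply/seteqP; split => w.
    move=> [sw mw]; split.
      by split => // j jM; apply: mw; exact: leq_trans jM (leqnSn M).
    move=> [bw _]; apply: (mw M (ltnSn M)) => i /= ib.
    by apply: bw; rewrite /= mem_cat ib.
  move=> [[sw mw] nw]; split => // j.
  rewrite /= ltnS leq_eqVlt => /orP[/eqP ->|]; last exact: mw.
  move=> bw; apply: nw; split => // i; rewrite /= mem_cat => /orP[ib|].
    exact: bw.
  exact: sw.
have fin s' : (\prod_(i <- s') Pr (S i @^-1` B i))%E \is a fin_num.
  by apply: prode_fin_num => i _; apply: fin_num_measure; exact: measurable_S.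
rewrite sub measureD//=; [|by apply: measurableI|by apply: measurableI|]; last first.
  by rewrite ltey_eq fin_num_measure//; exact: measurableI.
rewrite [X in (_ - Pr X)%E]setIidr; last first.
  move=> w [bw mw]; split => // i /= si.
  by apply: bw; rewrite /= mem_cat si orbT.
rewrite !IH//; last first.
- move=> i; rewrite mem_cat => /orP[|/sM'//].
  by rewrite mem_iota => /andP[].
- rewrite cat_uniq iota_uniq us andbT; apply/hasPn => i /sM.
  by rewrite mulSn addnC mem_iota negb_and -[~~ (_ < _)%N]leqNgt => ->; rewrite orbT.
rewrite big_cat/= p_block -(fineK (fin s)) -!EFinM -EFinB; congr EFin.
by rewrite exprS; ring.
Qed.

(** Each block misses with probability [1 - p], so the first [M] of them all miss with
probability [(1 - p) ^+ M], which tends to [0]. *)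
Lemma ae_hit_block : 0 < p -> {ae Pr, forall w, exists j, event (block j) w}.
Proof.
move=> p0; pose N := \bigcap_j ~` event (block j).
have mN : measurable N by apply: bigcapT_measurable => j; exact: measurableC.
have NM M : (Pr N <= ((1 - p) ^+ M)%:E)%E.
  have <- : Pr (event [::] `&` miss M) = ((1 - p) ^+ M)%:E.
    by rewrite miss_blocks// big_nil mul1e.
  apply: le_measure; rewrite ?inE//; first exact: measurableI.
  by move=> w Nw; split => // j _; exact: Nw.
have p1 : 0 <= 1 - p.
  by rewrite -lee_fin -[1 - p]expr1; apply: le_trans (NM 1%N).
have N0 : Pr N = 0%E.
  apply/eqP; rewrite eq_le measure_ge0 andbT.
  have cq : ((1 - p) ^+ M)%:E @[M --> \oo] --> 0%E.
    apply: cvg_EFin; first by apply: nearW.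
    apply: cvg_expr; rewrite ger0_norm//; lra.
  by apply: (cvge_to_ge cq); apply: nearW => M; exact: NM.
exists N; split => // w /= /forallNP nw j _; exact: nw.
Qed.

End independent_blocks.

(** * The equivalence *)

Section convergence.
Context {R : realType} {n : nat} (mu : probability (projective_space R n) R).
Context {d : measure_display} {Omega : measurableType d} (Pr : probability Omega R).
Variable S : nat -> {RV Pr >-> projective_space R n}.
Hypothesis S_indep : mutually_independent S.
Hypothesis S_distr : forall i (A : set (projective_space R n)),
  measurable A -> distribution Pr (S i) A = mu A.
Local Notation P := (projective_space R n).
Local Notation m := (@lebesgue_rV R n.+1).
Implicit Types (X Y : set 'rV[R]_n.+1).

Let path w k : seq P := mkseq (fun i => S i w) k.

Lemma cvge_to0 (f : nat -> \bar R) : (forall k, (0 <= f k)%E) ->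
  (forall e : R, 0 < e -> exists N, forall k, (N <= k)%N -> (f k <= e%:E)%E) ->
  f k @[k --> \oo] --> 0%E.
Proof.
move=> f0 fe; have [N fN] := fe _ ltr01.
apply/fine_cvgP; split.
  exists N => // k /= Nk; rewrite ge0_fin_numE//.
  by apply: le_lt_trans (fN _ Nk) _; rewrite ltry.
apply/cvgrPdist_le => e e0; have [M fM] := fe _ e0.
exists (maxn N M) => // k /=; rewrite geq_max => /andP[Nk Mk].
have kfin : f k \is a fin_num.
  by rewrite ge0_fin_numE//; apply: le_lt_trans (fN _ Nk) _; rewrite ltry.
by rewrite sub0r normrN ger0_norm ?fine_ge0// -lee_fin fineK// fM.
Qed.

Lemma mkseq_cat (T : Type) (f : nat -> T) a b :
  mkseq f (a + b) = mkseq f a ++ mkseq (fun i => f (a + i)%N) b.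
Proof. by rewrite /mkseq iotaD map_cat add0n -[a in iota a b]addn0 iotaDl -map_comp. Qed.

Lemma word_in_mkseq (Us : seq (set P)) (f : nat -> P) :
  (forall i, (i < size Us)%N -> nth setT Us i (f i)) -> word_in Us (mkseq f (size Us)).
Proof.
elim: Us f => //= U Us IH f fU; split; first exact: (fU 0%N).
rewrite -[1%N]addn0 iotaDl -map_comp; apply: IH => i iU.
exact: (fU i.+1).
Qed.

Lemma ae_word_in (Us : seq (set P)) : positive_opens mu Us ->
  {ae Pr, forall w, exists a, word_in Us (mkseq (fun i => S (a + i)%N w) (size Us))}.
Proof.
move=> Uso; pose k := size Us; pose B i := nth setT Us (i %% k).
have oB i : open (B i) /\ (0 < mu (B i))%E.
  rewrite /B; have [ik|ki] := ltnP (i %% k) k; first exact/Uso/mem_nth.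
  by rewrite nth_default// probability_setT; split => //; exact: openT.
have mB i : measurable (B i) by apply: open_measurable_projective; case: (oB i).
have BE i : Pr (S i @^-1` B i) = mu (B i) by rewrite -(S_distr i (mB i)).
pose p := \prod_(i <- iota 0 k) fine (mu (B i)).
have fB i : mu (B i) \is a fin_num by exact: fin_num_measure.
have p0 : 0 < p.
  rewrite /p; elim/big_ind : _ => // [x y x0 y0|i _]; first exact: mulr_gt0.
  by rewrite -lte_fin fineK//; case: (oB i).
have p_block j : (\prod_(i <- iota (j * k) k) Pr (S i @^-1` B i) = p%:E)%E.
  rewrite -[(j * k)%N]addn0 iotaDl big_map /p -prodEFin; apply: eq_bigr => i _.
  by rewrite BE fineK// /B modnMDl.
have := ae_hit_block S_indep mB p_block p0.
apply: filterS => w [j jw]; exists (j * k)%N; apply: word_in_mkseq => i ik.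
have := jw (j * k + i)%N; rewrite /= mem_iota leq_addr ltn_add2l => /(_ ik).
by rewrite /B modnMDl modn_small.
Qed.

(** Approximate [X] by good sets [C l]. Almost surely each [C l] meets a block of
directions that brings it close to its ball, after which it stays there; and [X]
follows [C l], as symmetrizations and rearrangement contract the distance. *)
Lemma moved_ae_cvg :
  (forall X, lebesgue_measurable X -> (m X < +oo)%E ->
    (0 < m (X `+` rearrangement X))%E ->
    (0 < mu [set u | (0 < m (X `+` steiner u X))%E])%E) ->
  forall X, lebesgue_measurable X -> (m X < +oo)%E ->
    \forall w \ae Pr,
      m (steiner_seq X (path w k) `+` rearrangement X) @[k --> \oo] --> 0%E.
Proof.
move=> moved X mX Xoo; have Xf : finite_lebesgue X by [].
pose e l : R := l.+1%:R^-1; have e0 l : 0 < e l by rewrite invr_gt0.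
have /choice[C CP] l : exists C, good C /\ (rV_dist X C <= (e l)%:E)%E.
  by have [C gC XC] := good_dense Xf (e0 l); exists C.
have /choice[Us UsP] l : exists Us, positive_opens mu Us /\
    forall t s, word_in Us s ->
      (rV_dist (steiner_seq (C l) (t ++ s)) (rearrangement (C l)) <= (e l)%:E)%E.
  by have [Us ? ?] := ex_rounding_opens moved (CP l).1 (e0 l); exists Us.
have : {ae Pr, forall w l, exists a,
    word_in (Us l) (mkseq (fun i => S (a + i)%N w) (size (Us l)))}.
  by apply: ae_foralln => l; exact/ae_word_in/(UsP l).1.
apply: filterS => w hit.
apply: cvge_to0 => [k|f f0]; first exact: rV_ge0.
have f30 : 0 < f / 3 by rewrite divr_gt0.
near \oo => l.
have ef : e l <= f / 3.
  by apply: ltW; near: l; exact: (near_infty_natSinv_lt (PosNum f30)).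
have [gC XC] := CP l; have Cf := good_finite gC.
have [a aw] := hit l; exists (a + size (Us l))%N => k ak.
have Ck : (rV_dist (steiner_seq (C l) (path w k)) (rearrangement (C l)) <= (e l)%:E)%E.
  rewrite /path -(subnKC ak) mkseq_cat steiner_seq_cat.
  apply: le_trans (rV_dist_seq_rearrangement _ _ Cf) _; first exact: finite_lebesgue_seq.
  by rewrite mkseq_cat; exact: (UsP l).2.
rewrite -/(rV_dist _ _).
apply: le_trans (rV_dist_triangle (steiner_seq (C l) (path w k)) _ _) _.
apply: (@le_trans _ _ ((e l)%:E + ((e l)%:E + (e l)%:E))%E); last first.
  by rewrite -!EFinD lee_fin; lra.
apply: leeD; first by apply: le_trans XC; exact: rV_dist_seq.
apply: le_trans (rV_dist_triangle (rearrangement (C l)) _ _) _; apply: leeD => //.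
apply: le_trans (rV_dist_rearrangement Cf.2 Xoo) _.
by rewrite rV_distC.
Unshelve. all: by end_near. Qed.

(** If almost no direction moves [X], then almost surely all images of [X] equal [X] up
to null sets, and their limit is [X]. *)
Lemma ae_cvg_moved :
  (forall X, lebesgue_measurable X -> (m X < +oo)%E ->
    \forall w \ae Pr,
      m (steiner_seq X (path w k) `+` rearrangement X) @[k --> \oo] --> 0%E) ->
  forall X, lebesgue_measurable X -> (m X < +oo)%E ->
    (0 < m (X `+` rearrangement X))%E ->
    (0 < mu [set u | (0 < m (X `+` steiner u X))%E])%E.
Proof.
move=> cvg X mX Xoo X0; have Xf : finite_lebesgue X by [].
set E := [set u | _].
have mE : measurable E.
  by apply: open_measurable_projective; exact: (open_steiner_dist_gt0 Xf Xf).
rewrite ltNge; apply/negP => E0.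
have {}E0 : mu E = 0%E by apply/eqP; rewrite eq_le E0 measure_ge0.
have fixed : {ae Pr, forall w i, ~ E (S i w)}.
  apply: ae_foralln => i; exists (S i @^-1` E); split.
  - exact: (measurable_preimage (measurable_funPT (S i))).
  - by rewrite -E0 -(S_distr i mE).
  - by move=> w /= /contrapT.
have [w [Ew cw]] : exists w, (forall i, ~ E (S i w)) /\
    m (steiner_seq X (path w k) `+` rearrangement X) @[k --> \oo] --> 0%E.
  apply: contrapT => /forallNP now.
  have [N [mN N0 TN]] := filterI fixed (cvg X mX Xoo).
  have : (Pr setT <= 0)%E.
    rewrite -N0; apply: le_measure; rewrite ?inE// => w _.
    by apply: TN => -[? ?]; exact: (now w).
  by rewrite probability_setT leNgt lte01.
have path0 k : rV_dist X (steiner_seq X (path w k)) = 0%E.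
  elim: k => [|k IH]; first exact: rV_distxx.
  have u1 := unit_dir_unit (S k w).
  rewrite /path mkseqS /steiner_seq foldl_rcons -/(steiner_seq X (path w k)).
  have /negP := Ew k; rewrite -leNgt => Ek.
  apply: rV_eq0; apply: le_trans (rV_dist_triangle (steiner (S k w) X) _ _) _.
  rewrite -[leRHS]adde0; apply: leeD => //.
  apply: le_trans (rV_dist_steiner u1 Xf _) _; last by rewrite IH.
  exact: finite_lebesgue_seq.
have : (m (X `+` rearrangement X) <= 0)%E.
  apply: (cvge_to_ge cw); apply: nearW => k.
  have := rV_dist_triangle (steiner_seq X (path w k)) X (rearrangement X).
  by rewrite path0 add0e.
by rewrite leNgt X0.
Qed.

End convergence.

Theorem theorem1p1 (R : realType) (n : nat)
    (mu : probability (projective_space R n) R)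
    (d : measure_display) (Omega : measurableType d) (P : probability Omega R)
    (S : nat -> {RV P >-> projective_space R n})
    (S_indep : mutually_independent S)
    (S_distr : forall i (A : set (projective_space R n)),
       measurable A -> distribution P (S i) A = mu A) :
  (forall X : set 'rV[R]_n.+1,
     lebesgue_measurable X -> (lebesgue_rV X < +oo)%E ->
     (0 < lebesgue_rV (X `+` rearrangement X))%E ->
     (0 < mu [set u | (0 < lebesgue_rV (X `+` steiner u X))%E])%E) <->
  (forall X : set 'rV[R]_n.+1,
     lebesgue_measurable X -> (lebesgue_rV X < +oo)%E ->
     \forall w \ae P,
       lebesgue_rV (steiner_seq X (mkseq (fun i => S i w) k) `+`
         rearrangement X) @[k --> \oo] --> 0%E).
Proof.
by split; [exact: moved_ae_cvg | exact: ae_cvg_moved].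
Qed.
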